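(* Let $(\Omega,\mu)$ be a complete measure space with $\mu(\Omega)=\infty$, and let $E$ be a fully symmetric space on $(\Omega,\mu)$ with $\mathbf 1=\chi_\Omega\notin E$. Assume that either (a) $E$ consists of real-valued functions and $T$ is a Dunford-Schwartz operator on the real space $\mathcal L^1+\mathcal L^\infty$, or (b) $E$ consists of complex-valued functions and $T$ is a positive Dunford-Schwartz operator on the complex space $\mathcal L^1+\mathcal L^\infty$. Then for every $f\in E$ the averages $$a_n(f)=\frac1n\sum_{k=0}^{n-1}T^k(f)$$ converge almost everywhere to some $\widehat f\in E$.
   Context: Functions are identified when equal a.e. In case (a) all function spaces are real, in case (b) complex. For $f\in\mathcal L^1+\mathcal L^\infty$ the non-increasing rearrangement is $\mu_t(f)=\inf\{\lambda>0:\mu\{|f|>\lambda\}\le t\}$, $t>0$. A Banach space $(E,\|\cdot\|_E)$ that is a linear subspace of $\mathcal L^1+\mathcal L^\infty$ is called fully symmetric if $f\in E$, $g\in\mathcal L^1+\mathcal L^\infty$ and $\int_0^s\mu_t(g)\,dt\le\int_0^s\mu_t(f)\,dt$ for all $s>0$ imply $g\in E$ and $\|g\|_E\le\|f\|_E$. A linear operator $T:\mathcal L^1+\mathcal L^\infty\to\mathcal L^1+\mathcal L^\infty$ is a Dunford-Schwartz operator if $\|T(f)\|_1\le\|f\|_1$ for all $f\in\mathcal L^1$ and $\|T(f)\|_\infty\le\|f\|_\infty$ for all $f\in\mathcal L^\infty$. It is positive if it maps nonnegative functions to nonnegative functions. *)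

(* Defs.v *)
From HB Require Import structures.
From mathcomp Require Import all_boot all_order all_algebra.
From mathcomp Require Import all_classical all_reals all_analysis.
From mathcomp Require Import measurable_realfun.
From mathcomp Require Import complex.
Set Implicit Arguments.
Unset Strict Implicit.
Unset Printing Implicit Defensive.
Import Order.TTheory GRing.Theory Num.Theory.
Import numFieldTopology.Exports numFieldNormedType.Exports.
Local Open Scope classical_set_scope.
Local Open Scope ring_scope.

(* Elements of the function spaces are represented by measurable functions;
   classes modulo a.e. equality are handled by requiring every operation and
   every space to be compatible with equality a.e. *)

(* The modulus takes values in R: on R[i] the norm of the library, `|z|,
   is itself a complex number. *)
Definition real_modulus (R : realType) (x : R) : R := `|x|.
Definition complex_modulus (R : realType) (z : R[i]) : R :=
  ComplexField.Normc.normc z.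

Section function_spaces.
Context {d : measure_display} {T : measurableType d} {R : realType}.
Variable mu : {measure set T -> \bar R}.
(* The scalar field K is meant to be R or R[i], and md its modulus. *)
Context {K : numFieldType}.
Variable md : K -> R.
Implicit Types (f g h : T -> K) (E : set (T -> K)) (N : (T -> K) -> R).

(* For K = R this is measurable_fun setT f (see borel_funE below). *)
Definition borel_fun f := forall U : set K, open U -> measurable (f @^-1` U).

Definition Lpnorm (p : \bar R) f : \bar R :=
  Lnorm mu p (fun x => (md (f x))%:E).

Definition Lp (p : \bar R) : set (T -> K) :=
  [set f | borel_fun f /\ (Lpnorm p f < +oo)%E].

Definition L1_plus_Linfty : set (T -> K) :=
  [set f | exists g h, [/\ Lp 1%E g, Lp +oo%E h & f = (fun x => g x + h x)]].

Definition rearrangement f (t : R) : \bar R :=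
  ereal_inf [set l%:E | l in
    [set l : R | 0 < l /\ (mu [set x | (l < md (f x))%R] <= t%:E)%E]].

Definition submajorized g f := forall s : R, 0 < s ->
  (\int[lebesgue_measure]_(t in `]0%R, s]) rearrangement g t <=
   \int[lebesgue_measure]_(t in `]0%R, s]) rearrangement f t)%E.

Record banach_subspace E N : Prop := {
  bs_sub : E `<=` L1_plus_Linfty ;
  bs_ae : forall f g, E f -> L1_plus_Linfty g -> f = g %[ae mu] ->
    E g /\ N g = N f ;
  bs_zero : E (fun=> 0) ;
  bs_add : forall f g, E f -> E g -> E (fun x => f x + g x) ;
  bs_scale : forall (a : K) f, E f -> E (fun x => a * f x) ;
  bs_norm_ge0 : forall f, E f -> 0 <= N f ;
  bs_norm_eq0 : forall f, E f -> N f = 0 -> f = (fun=> 0) %[ae mu] ;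
  bs_norm_add : forall f g, E f -> E g -> N (fun x => f x + g x) <= N f + N g ;
  bs_norm_scale : forall (a : K) f, E f -> N (fun x => a * f x) = md a * N f ;
  bs_complete : forall u : nat -> T -> K, (forall n, E (u n)) ->
    (forall e : R, 0 < e -> exists n0 : nat, forall m n : nat,
      (n0 <= m)%N -> (n0 <= n)%N -> N (fun x => u m x - u n x) < e) ->
    exists2 f, E f & (fun n => N (fun x => u n x - f x)) @ \oo --> (0 : R) }.

Record fully_symmetric E N : Prop := {
  fs_banach : banach_subspace E N ;
  fs_submajorized : forall f g, E f -> L1_plus_Linfty g -> submajorized g f ->
    E g /\ N g <= N f }.

(* A : (T -> K) -> (T -> K) is only constrained on L1_plus_Linfty; the norm
   inequalities are between elements of [0, +oo]. *)
Record dunford_schwartz (A : (T -> K) -> (T -> K)) : Prop := {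
  ds_stable : forall f, L1_plus_Linfty f -> L1_plus_Linfty (A f) ;
  ds_ae : forall f g, L1_plus_Linfty f -> L1_plus_Linfty g ->
    f = g %[ae mu] -> A f = A g %[ae mu] ;
  ds_add : forall f g, L1_plus_Linfty f -> L1_plus_Linfty g ->
    A (fun x => f x + g x) = (fun x => A f x + A g x) %[ae mu] ;
  ds_scale : forall (a : K) f, L1_plus_Linfty f ->
    A (fun x => a * f x) = (fun x => a * A f x) %[ae mu] ;
  ds_norm1 : forall f, Lp 1%E f -> (Lpnorm 1%E (A f) <= Lpnorm 1%E f)%E ;
  ds_normy : forall f, Lp +oo%E f ->
    (Lpnorm +oo%E (A f) <= Lpnorm +oo%E f)%E }.

(* On R[i], 0 <= z means that z is real and nonnegative. *)
Definition positive_operator (A : (T -> K) -> (T -> K)) :=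
  forall f, L1_plus_Linfty f -> {ae mu, forall x, 0 <= f x} ->
    {ae mu, forall x, 0 <= A f x}.

(* Only n > 0 is meaningful. *)
Definition ergodic_average (A : (T -> K) -> (T -> K)) f (n : nat) (x : T) : K :=
  n%:R^-1 * \sum_(k < n) iter k A f x.

Definition cvg_ae (u : nat -> T -> K) f :=
  {ae mu, forall x, u n x @[n --> \oo] --> f x}.

End function_spaces.

Lemma borel_funE d (T : measurableType d) (R : realType) (f : T -> R) :
  borel_fun f <-> measurable_fun setT f.
Proof.
split=> [bf|mf U oU]; last first.
  by rewrite -[X in measurable X]setTI; apply: mf => //; exact: open_measurable.
apply: (measurability _ (RGenOpens.measurableE R)).
by move=> _ [_ [a [b ->]] <-]; rewrite setTI; apply: bf; exact: interval_open.
Qed.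

(* Main.v *)
(** For a function f and a level a, let the excess of f over a be the integral
    of (|f| - a)^+. Truncating f at height a splits it into an integrable and a
    bounded part, so a Dunford-Schwartz operator does not increase any excess;
    and since the integral of the rearrangement over [0, s] is the minimum over
    a of (excess over a) + s a, a function all of whose excesses are dominated
    by those of f is submajorized by f. By Fatou's lemma this applies to an a.e.
    limit of the averages of f in E, which hence lies in E.

    For the convergence, 1 is not in E, so f has level sets of finite measure
    and differs from a bounded, integrable function by the sum of a uniformly
    small and an L^1-small function. Chacon's filling scheme, which does not
    need positivity, gives a maximal inequality that makes the set of functions
    with convergent averages closed under such approximations. It contains the
    bounded square integrable functions: by Riesz's argument, the nearly
    norm-minimizing elements of the convex hull of the orbit of f converge in
    L^2 to a fixed point of T, and their differences with f are sums of bounded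
    coboundaries. A positive operator maps real functions to real functions,
    which reduces the complex case to the real one. *)

Require Import Defs.
From HB Require Import structures.
From mathcomp Require Import all_boot all_order all_algebra.
From mathcomp Require Import all_classical all_reals all_analysis.
From mathcomp Require Import measurable_realfun ess_sup_inf.
From mathcomp Require Import complex lra.
Set Implicit Arguments.
Unset Strict Implicit.
Unset Printing Implicit Defensive.
Import Order.TTheory GRing.Theory Num.Theory.
Import numFieldTopology.Exports numFieldNormedType.Exports.
Local Open Scope classical_set_scope.
Local Open Scope ring_scope.

(** The real case offers no positivity, so T cannot be compared pointwise with its action on |f|, as
    Hopf's maximal lemma would require; and f need not belong to any single L^p. Both difficulties
    are met by recording of T only that it is linear almost everywhere and increases no excess. This
    one condition contains the L^1 bound (level 0), the L^oo bound (vanishing excess) and, after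
    integration over all levels, the L^2 bound, so the filling scheme, the coboundaries and Riesz's
    argument all draw on it. The excess also measures approximation: if the excess of f - g over e
    is at most e^2, the maximal inequality leaves a bad set of measure at most 2 e.

    The role of 1 is the following: were {|f| > l} of infinite measure, f / l would have a
    rearrangement at least 1 everywhere, hence submajorize 1 and force 1 into E. *)

(** * Truncation of real numbers *)

Section clip.
Context {R : realType}.
Implicit Types a x : R.

Definition clip a x : R := Num.max (- a) (Num.min a x).

Lemma clipP a x : 0 <= a ->
  [\/ `|x| <= a /\ clip a x = x, a < x /\ clip a x = a |
      x < - a /\ clip a x = - a].
Proof.
rewrite /clip => a0; have [ax|xa] := ltP a x.
  by apply: Or32; rewrite max_r//; lra.
have [xNa|Nax] := ltP x (- a); first by apply: Or33.
by apply: Or31; rewrite ler_norml Nax.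
Qed.

Lemma norm_clip a x : 0 <= a -> `|clip a x| = Num.min a `|x|.
Proof.
move=> a0; case: (clipP x a0) => -[xa ->].
- by rewrite min_r.
- by rewrite ger0_norm// min_l// (le_trans (ltW xa))// ler_norm.
- by rewrite normrN ger0_norm// min_l// -normrN ler_normr; apply/orP; left; lra.
Qed.

Lemma norm_clip_le a x : 0 <= a -> `|clip a x| <= a.
Proof. by move=> a0; rewrite norm_clip// ge_min lexx. Qed.

Lemma norm_sub_clip a x : 0 <= a -> `|x - clip a x| = Num.max (`|x| - a) 0.
Proof.
move=> a0; case: (clipP x a0) => -[xa ->].
- by rewrite subrr normr0 max_r// subr_le0.
- by rewrite !ger0_norm ?max_l//; lra.
- by rewrite !ler0_norm ?max_l//; lra.
Qed.

(** The two pieces have the same sign and never cancel. This exactness is what conserves mass in the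
    filling scheme. *)
Lemma norm_clipD a x : 0 <= a -> `|clip a x| + `|x - clip a x| = `|x|.
Proof.
move=> a0; rewrite norm_clip// norm_sub_clip//.
by have [ax|xa] := leP a `|x|; [rewrite max_l|rewrite max_r]; rewrite ?minEle; lra.
Qed.

End clip.

(** * Integrals of nonnegative real functions *)

Section integral_toolkit.
Context d (T : measurableType d) (R : realType) (mu : {measure set T -> \bar R}).
Implicit Types f g : T -> R.

Lemma measurable_set_bool (b : T -> bool) :
  measurable_fun setT b -> measurable [set x | b x].
Proof.
move=> mb; rewrite -[X in measurable X]setTI.
by have := mb measurableT [set true]; rewrite preimage_true; exact.
Qed.

Lemma ae_le_integral_EFin f g : measurable_fun setT f -> measurable_fun setT g ->
  (forall x, 0 <= f x) -> (forall x, 0 <= g x) ->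
  (\forall x \ae mu, f x <= g x) ->
  (\int[mu]_x (f x)%:E <= \int[mu]_x (g x)%:E)%E.
Proof.
move=> mf mg f0 g0 fg; apply: ae_ge0_le_integral => //.
- by move=> x _; rewrite lee_fin.
- exact/measurable_EFinP.
- by move=> x _; rewrite lee_fin.
- exact/measurable_EFinP.
- by apply: filterS fg => x fgx _; rewrite lee_fin.
Qed.

(** Fatou's lemma in the form needed for limits that exist only almost everywhere and come with a
    common bound on the integrals. *)
Lemma integral_limit_le (u : nat -> T -> R) f (c : \bar R) :
  (forall n, measurable_fun setT (u n)) -> measurable_fun setT f ->
  (forall n x, 0 <= u n x) -> (forall x, 0 <= f x) ->
  (\forall x \ae mu, u n x @[n --> \oo] --> f x) ->
  (forall n, \int[mu]_x (u n x)%:E <= c)%E ->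
  (\int[mu]_x (f x)%:E <= c)%E.
Proof.
move=> mu_ mf u0 f0 uf uc.
apply: (@le_trans _ _ (limn_einf (fun n => \int[mu]_x (u n x)%:E)%E)).
  have mEu n : measurable_fun setT (fun x => (u n x)%:E).
    exact/measurable_EFinP.
  apply: le_trans (fatou mu measurableT mEu _); last first.
    by move=> n x _; rewrite lee_fin.
  apply: ae_ge0_le_integral => //.
  - by move=> x _; rewrite lee_fin.
  - exact/measurable_EFinP.
  - move=> x _; rewrite limn_einf_lim; apply: lime_ge.
      exact: is_cvg_einfs.
    apply: nearW => n; apply: le_ereal_inf_tmp => _ [m _ <-].
    by rewrite lee_fin.
  - under [X in measurable_fun _ X]eq_fun do rewrite /limn_einf.
    apply: measurableT_comp => //; apply: measurable_fun_limn_esup => n.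
    exact: measurableT_comp.
  - apply: filterS uf => x uf _.
    have [-> _]// : (limn_einf (fun n => (u n x)%:E) = (f x)%:E) *
      (limn_esup (fun n => (u n x)%:E) = (f x)%:E).
    by apply: cvg_limn_einf_sup; exact/cvg_EFin/uf/nearW.
rewrite limn_einf_lim; apply: lime_le; first exact: is_cvg_einfs.
apply: nearW => n; apply: le_trans (uc n).
by apply: ereal_inf_lbound; exists n => /=.
Qed.

Lemma integral_EFinD f g : measurable_fun setT f -> measurable_fun setT g ->
  (forall x, 0 <= f x) -> (forall x, 0 <= g x) ->
  (\int[mu]_x (f x + g x)%:E = \int[mu]_x (f x)%:E + \int[mu]_x (g x)%:E)%E.
Proof.
move=> mf mg f0 g0; under eq_integral do rewrite EFinD.
by rewrite ge0_integralD//; first [by move=> x _; rewrite lee_fin|exact/measurable_EFinP].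
Qed.

Lemma integral_EFinZ (k : R) f : measurable_fun setT f -> 0 <= k ->
  (forall x, 0 <= f x) ->
  (\int[mu]_x (k * f x)%:E = k%:E * \int[mu]_x (f x)%:E)%E.
Proof.
move=> mf k0 f0; under eq_integral do rewrite EFinM.
by rewrite ge0_integralZl_EFin//; [move=> x _; rewrite lee_fin|exact/measurable_EFinP].
Qed.

Lemma integral_markov (a : R) f : measurable_fun setT f ->
  (forall x, 0 <= f x) -> 0 < a ->
  (a%:E * mu [set x | (a <= f x)%R] <= \int[mu]_x (f x)%:E)%E.
Proof.
move=> mf f0 a0.
have aE : [set x | (a <= f x)%R] = [set x | (a%:E <= `|(f x)%:E|)%E].
  by apply/funext => x /=; rewrite lee_fin ger0_norm.
have mEf : measurable_fun setT (EFin \o f) by exact/measurable_EFinP.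
have := @le_integral_comp_abse _ _ _ mu setT measurableT (EFin \o f) a id.
rewrite setTI /= aE => H; apply: le_trans (H _ _ _ _ _) _ => //.
apply: ge0_le_integral => //.
  by apply/measurable_EFinP; exact: measurableT_comp.
by move=> x _; rewrite lee_fin ger0_norm.
Qed.

End integral_toolkit.

(** * Excess over a level *)

Section excess.
Context d (T : measurableType d) (R : realType) (mu : {measure set T -> \bar R}).
Implicit Types (f g : T -> R) (a b : R).

(* The K-functional of (L^1, L^oo) is [inf_a (excess f a + s * a)], so control
   of all the [excess f a] is what interpolates between the two endpoints. *)
Definition excess f a : \bar R := (\int[mu]_x (Num.max (`|f x| - a) 0)%:E)%E.

Definition finite_excess f := measurable_fun setT f /\
  exists2 a : R, 0 <= a & (excess f a < +oo)%E.

Lemma measurable_excess f a : measurable_fun setT f ->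
  measurable_fun setT (fun x => Num.max (`|f x| - a) 0).
Proof.
move=> mf; apply: measurable_maxr => //; apply: measurable_funB => //.
exact: measurableT_comp.
Qed.

Lemma measurable_clip f a : measurable_fun setT f ->
  measurable_fun setT (fun x => clip a (f x)).
Proof.
by move=> mf; apply: measurable_maxr => //; apply: measurable_minr.
Qed.

Lemma max_sub_ge0 (x a : R) : 0 <= Num.max (x - a) 0.
Proof. by rewrite le_max lexx orbT. Qed.

Lemma max_sub_le (x a y : R) : 0 <= y -> x <= y + a -> Num.max (x - a) 0 <= y.
Proof. by move=> y0 xya; rewrite ge_max y0 andbT lerBlDr. Qed.

Lemma le_max_sub (x a : R) : x <= Num.max (x - a) 0 + a.
Proof. by rewrite -lerBlDr le_max lexx. Qed.

Lemma excess_ge0 f a : (0 <= excess f a)%E.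
Proof. by apply: integral_ge0 => x _; rewrite lee_fin max_sub_ge0. Qed.

(** The positive part of |f| - a is the least nonnegative function g with |f| <= g + a. Most bounds
    on an excess below are obtained by exhibiting such a g. *)
Lemma excess_le_integral f a (g : T -> R) : measurable_fun setT f ->
  measurable_fun setT g -> (forall x, 0 <= g x) ->
  (\forall x \ae mu, `|f x| <= g x + a) ->
  (excess f a <= \int[mu]_x (g x)%:E)%E.
Proof.
move=> mf mg g0 fg; apply: ae_le_integral_EFin => //.
- exact: measurable_excess.
- by move=> x; exact: max_sub_ge0.
- by apply: filterS fg => x; exact: max_sub_le.
Qed.

Lemma excess0 f : excess f 0 = (\int[mu]_x `|f x|%:E)%E.
Proof. by apply: eq_integral => x _; rewrite subr0 max_l. Qed.

Lemma le_excess f g a : measurable_fun setT f -> measurable_fun setT g ->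
  (\forall x \ae mu, `|f x| <= `|g x|) -> (excess f a <= excess g a)%E.
Proof.
move=> mf mg fg; apply: excess_le_integral => //.
- exact: measurable_excess.
- by move=> x; exact: max_sub_ge0.
- by apply: filterS fg => x /le_trans; apply; exact: le_max_sub.
Qed.

Lemma excess_nonincreasing f a b : measurable_fun setT f -> a <= b ->
  (excess f b <= excess f a)%E.
Proof.
move=> mf ab; apply: excess_le_integral => //.
- exact: measurable_excess.
- by move=> x; exact: max_sub_ge0.
- by apply: aeW => x; rewrite (le_trans (le_max_sub _ a))// lerD2l.
Qed.

(** Through this equivalence, control of the excess includes control of essential bounds. *)
Lemma excess_eq0 f a : measurable_fun setT f ->
  (\forall x \ae mu, `|f x| <= a) <-> excess f a = 0%E.
Proof.
move=> mf; split=> [fa|].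
  apply/eqP; rewrite eq_le excess_ge0 andbT.
  rewrite -(integral0 mu setT); apply: excess_le_integral => //.
  by apply: filterS fa => x; rewrite add0r.
move=> fa0.
have : (\int[mu]_x `|(Num.max (`|f x| - a) 0)%:E| = 0)%E.
  rewrite -fa0; apply: eq_integral => x _.
  by rewrite abse_EFin ger0_norm// max_sub_ge0.
move/ae_eq_integral_abs => /(_ measurableT).
have mE : measurable_fun setT (fun x => (Num.max (`|f x| - a) 0)%:E).
  by apply/measurable_EFinP; exact: measurable_excess.
move=> /(_ mE); apply: filterS => x /(_ I) [] fx0.
by have := le_max_sub `|f x| a; rewrite fx0 add0r.
Qed.

Lemma excessD f g a b : measurable_fun setT f -> measurable_fun setT g ->
  (excess (fun x => f x + g x)%R (a + b)%R <= excess f a + excess g b)%E.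
Proof.
move=> mf mg; rewrite /excess.
rewrite -integral_EFinD; [|exact: measurable_excess|exact: measurable_excess|
  by move=> x; exact: max_sub_ge0|by move=> x; exact: max_sub_ge0].
apply: excess_le_integral.
- exact: measurable_funD.
- by apply: measurable_funD; exact: measurable_excess.
- by move=> x; rewrite addr_ge0// max_sub_ge0.
- apply: aeW => x; rewrite (le_trans (ler_normD _ _))// addrACA.
  by rewrite lerD// le_max_sub.
Qed.

Lemma excessZ f a c : measurable_fun setT f -> 0 <= a ->
  excess (fun x => c * f x) (`|c| * a) = (`|c|%:E * excess f a)%E.
Proof.
move=> mf a0; rewrite /excess -integral_EFinZ//.
- apply: eq_integral => x _; rewrite normrM -mulrBr.
  by rewrite -[in LHS](mulr0 `|c|) -maxr_pMr.
- exact: measurable_excess.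
- by move=> x; exact: max_sub_ge0.
Qed.

Lemma excess_sub_clip f a : measurable_fun setT f -> 0 <= a ->
  excess (fun x => f x - clip a (f x)) 0 = excess f a.
Proof.
by move=> mf a0; rewrite excess0; apply: eq_integral => x _; rewrite norm_sub_clip.
Qed.

Lemma excess_markov f a b : measurable_fun setT f -> 0 < b ->
  (b%:E * mu [set x | (a + b <= `|f x|)%R] <= excess f a)%E.
Proof.
move=> mf b0; apply: le_trans (integral_markov mu (measurable_excess a mf) _ b0) => //.
- rewrite lee_pmul2l// le_measure ?inE//.
  + by apply: measurable_set_bool; apply: measurable_fun_ler => //; exact: measurableT_comp.
  + by apply: measurable_set_bool; apply: measurable_fun_ler => //; exact: measurable_excess.
  + by move=> x /= abf; rewrite le_max lerBrDl abf.
- by move=> x; exact: max_sub_ge0.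
Qed.

End excess.

Section finite_excess.
Context d (T : measurableType d) (R : realType) (mu : {measure set T -> \bar R}).
Implicit Types (f g : T -> R) (a b : R).
Local Notation excess := (excess mu).
Local Notation fe := (finite_excess mu).

Lemma finite_excess_bounded f a : measurable_fun setT f ->
  (\forall x \ae mu, `|f x| <= a) -> fe f.
Proof.
(* The bound [a] is not assumed nonnegative, whereas the level has to be. *)
move=> mf fa; split=> //; exists (Num.max a 0); first by rewrite le_max lexx orbT.
rewrite (excess_eq0 mu _ mf).1//.
by apply: filterS fa => x fxa; rewrite le_max fxa.
Qed.

Lemma finite_excess_cst a : fe (fun=> a).
Proof. by apply: (@finite_excess_bounded _ `|a|) => //; exact: aeW. Qed.

Lemma finite_excessD f g : fe f -> fe g -> fe (fun x => f x + g x).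
Proof.
move=> [mf [a a0 fa]] [mg [b b0 gb]]; split; first exact: measurable_funD.
exists (a + b); first exact: addr_ge0.
by apply: le_lt_trans (excessD mu a b mf mg) _; rewrite lte_add_pinfty.
Qed.

Lemma finite_excessZ c f : fe f -> fe (fun x => c * f x).
Proof.
move=> [mf [a a0 fa]]; split; first exact: measurable_funM.
exists (`|c| * a); first exact: mulr_ge0.
by rewrite excessZ// lte_mul_pinfty// lee_fin.
Qed.

Lemma finite_excessB f g : fe f -> fe g -> fe (fun x => f x - g x).
Proof.
move=> ff fg.
have -> : (fun x => f x - g x) = (fun x => f x + -1 * g x).
  by apply/funext => x; rewrite mulN1r.
by apply: finite_excessD => //; exact: finite_excessZ.
Qed.

Lemma finite_excess_sum (u : nat -> T -> R) n : (forall k, fe (u k)) ->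
  fe (fun x => \sum_(k < n) u k x).
Proof.
move=> fu; elim: n => [|n IHn].
  by under eq_fun do rewrite big_ord0; exact: finite_excess_cst.
by under eq_fun do rewrite big_ord_recr; exact: finite_excessD.
Qed.

Lemma finite_excess_le f g : measurable_fun setT f -> fe g ->
  (\forall x \ae mu, `|f x| <= `|g x|) -> fe f.
Proof.
move=> mf [mg [a a0 ga]] fg; split=> //; exists a => //.
exact: le_lt_trans (le_excess _ mf mg fg) _.
Qed.

End finite_excess.
#[global] Hint Resolve finite_excess_cst : core.

(* A is constrained only on functions with some finite excess, which are the
   real elements of L^1 + L^oo. *)
Record excess_contraction d (T : measurableType d) (R : realType)
    (mu : {measure set T -> \bar R}) (A : (T -> R) -> T -> R) : Prop := {
  ec_stable : forall f, finite_excess mu f -> finite_excess mu (A f) ;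
  ec_ae : forall f g, finite_excess mu f -> finite_excess mu g ->
    (\forall x \ae mu, f x = g x) -> (\forall x \ae mu, A f x = A g x) ;
  ec_add : forall f g, finite_excess mu f -> finite_excess mu g ->
    \forall x \ae mu, A (fun y => f y + g y) x = A f x + A g x ;
  ec_scale : forall c f, finite_excess mu f ->
    \forall x \ae mu, A (fun y => c * f y) x = c * A f x ;
  ec_excess : forall f a, finite_excess mu f -> 0 <= a ->
    (excess mu (A f) a <= excess mu f a)%E }.

(** * Iterates and averages of an excess contraction *)

Section excess_contraction.
Context d (T : measurableType d) (R : realType) (mu : {measure set T -> \bar R}).
Variables (A : (T -> R) -> T -> R) (ecA : excess_contraction mu A).
Implicit Types (f g : T -> R) (a b : R).
Local Notation excess := (excess mu).
Local Notation fe := (finite_excess mu).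
Local Notation avg := (ergodic_average A).

Definition orbit_sum f n x := \sum_(k < n) iter k A f x.

Lemma ec_bounded f a : fe f -> 0 <= a ->
  (\forall x \ae mu, `|f x| <= a) -> \forall x \ae mu, `|A f x| <= a.
Proof.
move=> ff a0 fa; apply/(excess_eq0 mu).
  exact: (ec_stable ecA ff).1.
apply/eqP; rewrite eq_le excess_ge0 andbT.
by rewrite (le_trans (ec_excess ecA ff a0))// (excess_eq0 mu _ ff.1).1.
Qed.

Lemma ec_sum (u : nat -> T -> R) n : (forall k, fe (u k)) ->
  \forall x \ae mu, A (fun y => \sum_(k < n) u k y) x = \sum_(k < n) A (u k) x.
Proof.
move=> fu; elim: n => [|n IHn].
  (* The empty sum requires A 0 = 0, which is homogeneity with the scalar 0. *)
  have A0 := ec_scale ecA 0 (@finite_excess_cst _ _ _ mu 0).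
  apply: filterS A0 => x A0x.
  rewrite big_ord0 -[RHS](mul0r (A (fun=> 0) x)) -A0x; congr (A _ x).
  by apply/funext => y; rewrite big_ord0 mul0r.
have AD := ec_add ecA (finite_excess_sum n fu) (fu n).
apply: filterS2 IHn AD => x IHn ADx; rewrite big_ord_recr/= -IHn -ADx.
by congr (A _ x); apply/funext => y; rewrite big_ord_recr.
Qed.

Lemma finite_excess_iter f k : fe f -> fe (iter k A f).
Proof. by move=> ff; elim: k => //= k; exact: ec_stable. Qed.

Lemma finite_excess_orbit_sum f n : fe f -> fe (orbit_sum f n).
Proof. by move=> ff; apply: finite_excess_sum => k; exact: finite_excess_iter. Qed.

Lemma finite_excess_avg f n : fe f -> fe (avg f n).
Proof. by move=> ff; apply: finite_excessZ; exact: finite_excess_orbit_sum. Qed.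

(** Additivity holds only off a null set, so the induction hypothesis has to be carried through [A]
    by [ec_ae]. *)
Lemma iter_add f g k : fe f -> fe g ->
  \forall x \ae mu, iter k A (fun y => f y + g y) x = iter k A f x + iter k A g x.
Proof.
move=> ff fg; elim: k => [|k IHk] /=; first exact: aeW.
have := ec_add ecA (finite_excess_iter k ff) (finite_excess_iter k fg).
apply: filterS2; last first.
  apply: (ec_ae ecA) IHk; first exact: finite_excess_iter (finite_excessD ff fg).
  by apply: finite_excessD; exact: finite_excess_iter.
by move=> x -> ->.
Qed.

Lemma iter_scale c f k : fe f ->
  \forall x \ae mu, iter k A (fun y => c * f y) x = c * iter k A f x.
Proof.
move=> ff; elim: k => [|k IHk] /=; first exact: aeW.
have := ec_scale ecA c (finite_excess_iter k ff).
apply: filterS2; last first.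
  apply: (ec_ae ecA) IHk; first exact: finite_excess_iter (finite_excessZ c ff).
  by apply: finite_excessZ; exact: finite_excess_iter.
by move=> x -> ->.
Qed.

(** One null set serves all [n], as is needed to discuss convergence at a point. *)
Lemma avgD f g : fe f -> fe g ->
  \forall x \ae mu, forall n, avg (fun y => f y + g y) n x = avg f n x + avg g n x.
Proof.
move=> ff fg; have := ae_foralln (fun k => iter_add k ff fg).
apply: filterS => x H n; rewrite /ergodic_average -mulrDr -big_split/=.
by congr (_ * _); apply: eq_bigr => k _; exact: H.
Qed.

Lemma avgZ c f : fe f ->
  \forall x \ae mu, forall n, avg (fun y => c * f y) n x = c * avg f n x.
Proof.
move=> ff; have := ae_foralln (fun k => iter_scale c k ff).
apply: filterS => x H n; rewrite /ergodic_average mulrCA; congr (_ * _).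
by rewrite mulr_sumr; apply: eq_bigr => k _; exact: H.
Qed.

Lemma avgB f g : fe f -> fe g ->
  \forall x \ae mu, forall n, avg (fun y => f y - g y) n x = avg f n x - avg g n x.
Proof.
move=> ff fg; have := avgD ff (finite_excessZ (-1) fg).
apply: filterS2 (avgZ (-1) fg) => x Nx Dx n.
rewrite -[RHS]/(_ + - _) -mulN1r -Nx -Dx; congr (ergodic_average A _ n x).
by apply/funext => y; rewrite mulN1r.
Qed.

Lemma orbit_sumS f n : fe f ->
  \forall x \ae mu, orbit_sum f n.+1 x = f x + A (orbit_sum f n) x.
Proof.
move=> ff; apply: filterS (ec_sum n (fun k => finite_excess_iter k ff)) => x Ex.
by rewrite /orbit_sum big_ord_recl/= Ex.
Qed.

Lemma iter_bounded f a : fe f -> 0 <= a -> (\forall x \ae mu, `|f x| <= a) ->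
  \forall x \ae mu, forall k, `|iter k A f x| <= a.
Proof.
move=> ff a0 fa; apply: ae_foralln; elim=> //= k; apply: ec_bounded => //.
exact: finite_excess_iter.
Qed.

End excess_contraction.

(** * The maximal inequality *)

Section maximal_inequality.
Context d (T : measurableType d) (R : realType) (mu : {measure set T -> \bar R}).
Variables (A : (T -> R) -> T -> R) (ecA : excess_contraction mu A).
Variables (f : T -> R) (a : R).
Hypothesis ff : finite_excess mu f.
Hypothesis a_gt0 : 0 < a.
Local Notation excess := (excess mu).
Local Notation fe := (finite_excess mu).
Local Notation avg := (ergodic_average A).

(* Chacon's filling scheme, which needs no positivity of A: the mass exceeding
   the level a is transported by A and, at each step, deposited at each point as
   long as the total variation [filled] of the deposits there is at most a. *)
Definition fill_step (s : (T -> R) * (T -> R) * (T -> R)) :=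
  let dep x := clip (a - s.2 x) (A s.1.1 x) in
  ((fun x => A s.1.1 x - dep x, fun x => s.1.2 x + dep x),
   fun x => s.2 x + `|dep x|).

Definition fill n := iter n fill_step ((fun x => f x - clip a (f x), fun=> 0), fun=> 0).
Definition residue n : T -> R := (fill n).1.1.
Definition deposit n : T -> R := (fill n).1.2.
Definition filled n : T -> R := (fill n).2.

Hypothesis fa : (excess f a < +oo)%E.

Let a_ge0 : 0 <= a. Proof. exact: ltW. Qed.

Lemma filled_itv n x : 0 <= filled n x <= a.
Proof.
elim: n => [|n /andP[IH0 IHa]]; first by rewrite lexx.
rewrite /filled/= addr_ge0//= -lerBrDl; apply: norm_clip_le.
by rewrite subr_ge0.
Qed.

Lemma filled_nondecreasing x : nondecreasing_seq (filled^~ x).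
Proof. by apply/nondecreasing_seqP => n; rewrite /filled/= lerDl. Qed.

Lemma norm_deposit_le n x : `|deposit n x| <= filled n x.
Proof.
elim: n => [|n IHn]; first by rewrite normr0.
by rewrite (le_trans (ler_normD _ _))// lerD2r.
Qed.

(** Truncation leaves a remainder only where it attains its bound, here the free capacity; the
    deposit then brings [filled] up to exactly a. *)
Lemma residue_eq0 n x : filled n.+1 x < a -> residue n.+1 x = 0.
Proof.
rewrite /filled /residue/= -/(filled n x) -/(residue n).
have a0 : 0 <= a - filled n x by rewrite subr_ge0; case/andP: (filled_itv n x).
case: (clipP (A (residue n) x) a0) => -[_ ->]; rewrite ?subrr//.
- by rewrite ger0_norm// subrKC ltxx.
- by rewrite normrN ger0_norm// subrKC ltxx.
Qed.

Lemma operator_residue n x :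
  A (residue n) x = residue n.+1 x + (deposit n.+1 x - deposit n x).
Proof. by rewrite /residue /deposit /= [X in _ + (X - _)]addrC addrK subrK. Qed.

(** The integral is a mass budget: transport by [A] does not increase the L^1 norm of the mass in
    transit ([ec_excess] at level 0), and depositing only moves mass from one summand to the
    other. *)
Lemma fill_inv n : [/\ fe (residue n), measurable_fun setT (deposit n),
  measurable_fun setT (filled n) &
  (\int[mu]_x (`|residue n x| + filled n x)%:E <= excess f a)%E].
Proof.
elim: n => [|n [fr md mf Irf]].
  split=> //.
  - split; first by apply: measurable_funB; [exact: ff.1|exact: measurable_clip ff.1].
    by exists 0 => //; rewrite excess_sub_clip//; exact: ff.1.
  - exact: measurable_cst.
  - exact: measurable_cst.
  - rewrite le_eqVlt; apply/orP; left; apply/eqP; apply: eq_integral => x _.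
    by rewrite [filled 0 x]/(0) addr0 norm_sub_clip.
have fAr := ec_stable ecA fr.
have mc : measurable_fun setT (fun x => clip (a - filled n x) (A (residue n) x)).
  apply: measurable_maxr; last by apply: measurable_minr; [exact: measurable_funB|exact: fAr.1].
  by apply: measurable_funN; exact: measurable_funB.
split.
- apply: (finite_excess_le _ fAr).
    by apply: measurable_funB => //; exact: fAr.1.
  apply: aeW => x.
  rewrite -[leRHS](@norm_clipD _ (a - filled n x)) ?lerDr//.
  by rewrite subr_ge0; case/andP: (filled_itv n x).
- exact: measurable_funD.
- by apply: measurable_funD => //; exact: measurableT_comp.
- apply: le_trans Irf.
  have f0 x : 0 <= filled n x by case/andP: (filled_itv n x).
  have mn (g : T -> R) : measurable_fun setT g -> measurable_fun setT (fun x => `|g x|).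
    by move=> mg; exact: measurableT_comp.
  (* Depositing is lossless by [norm_clipD]. *)
  have -> : (\int[mu]_x (`|residue n.+1 x| + filled n.+1 x)%:E =
             \int[mu]_x (`|A (residue n) x| + filled n x)%:E)%E.
    apply: eq_integral => x _; rewrite -[`|A _ x|](@norm_clipD _ (a - filled n x)).
      by rewrite /filled/= [X in _ = (X + _)%:E]addrC -addrA [X in _ = (_ + X)%:E]addrC.
    by rewrite subr_ge0; case/andP: (filled_itv n x).
  rewrite !integral_EFinD//; [|exact: mn fr.1|exact: mn fAr.1].
  by rewrite leeD2r// -!excess0; exact: ec_excess.
Qed.

Lemma measurable_full n : measurable [set x | a <= filled n x].
Proof.
apply: measurable_set_bool; apply: measurable_fun_ler => //.
by case: (fill_inv n).
Qed.

(** Markov's inequality and the budget of [fill_inv] bound the measure for each n; the sets increase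
    with n, so the bound survives in the union. *)
Lemma measure_full : (a%:E * mu (\bigcup_n [set x | (a <= filled n x)%R]) <= excess f a)%E.
Proof.
have H := @nondecreasing_cvg_mu _ _ _ mu (fun n => [set x | a <= filled n x])
  measurable_full (bigcup_measurable (fun n _ => measurable_full n)).
have {}H : (a%:E * mu [set x | (a <= filled n x)%R])%E @[n --> \oo] -->
    (a%:E * mu (\bigcup_n [set x | (a <= filled n x)%R]))%E.
  apply: cvgeZl => //; apply: H => m n mn; apply/subsetPset => x /= /le_trans; apply.
  exact: filled_nondecreasing.
rewrite -(cvg_lim _ H)//; apply: lime_le; first by apply/cvg_ex; eexists; exact: H.
apply: nearW => n; have [[mr _] _ mf Irf] := fill_inv n.
apply: le_trans Irf; apply: le_trans (integral_markov mu mf _ a_gt0) _.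
  by move=> x; case/andP: (filled_itv n x).
apply: ae_le_integral_EFin => //.
- by apply: measurable_funD => //; exact: measurableT_comp.
- by move=> x; case/andP: (filled_itv n x).
- by move=> x; rewrite addr_ge0//; case/andP: (filled_itv n x).
- by apply: aeW => x; rewrite lerDr.
Qed.

(** The recursion of the orbit sum, with its source f replaced by the bounded one consisting of the
    truncated f and of all deposits made so far. *)
Fixpoint spread n : T -> R := if n is m.+1 then
  fun x => A (spread m) x + (deposit m x + clip a (f x)) else fun=> 0.

Lemma norm_deposit_clip_le n x : `|deposit n x + clip a (f x)| <= 2 * a.
Proof.
rewrite mulr_natl mulr2n (le_trans (ler_normD _ _))// lerD ?norm_clip_le//.
by rewrite (le_trans (norm_deposit_le _ _))//; case/andP: (filled_itv n x).
Qed.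

(** Each step adds at most 2 a, namely a for the deposits and a for the truncated f, and [A]
    preserves essential bounds. *)
Lemma spread_bounded n : fe (spread n) /\
  \forall x \ae mu, `|spread n x| <= n%:R * (2 * a).
Proof.
elim: n => [|n [fs IHn]]; first by split; [exact: finite_excess_cst|apply: aeW => x; rewrite mul0r normr0].
have [_ md _ _] := fill_inv n.
split.
- apply: finite_excessD; first exact: ec_stable.
  apply: (@finite_excess_bounded _ _ _ _ _ (2 * a)).
    by apply: measurable_funD => //; exact: measurable_clip ff.1.
  by apply: aeW => x; exact: norm_deposit_clip_le.
- have na : 0 <= n%:R * (2 * a) by rewrite !mulr_ge0.
  apply: filterS (ec_bounded ecA fs na IHn) => x Ax.
  rewrite -natr1 mulrDl mul1r (le_trans (ler_normD _ _))// lerD//.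
  exact: norm_deposit_clip_le.
Qed.

(* Mass still in transit vanishes wherever the capacity is not exhausted, so there
   the orbit sum is the bounded function [spread n] up to [residue 0]. *)
Lemma orbit_sum_residue n :
  \forall x \ae mu, orbit_sum A f n x = \sum_(j < n) residue j x + spread n x.
Proof.
elim: n => [|n IHn].
  by apply: aeW => x; rewrite /orbit_sum !big_ord0 addr0.
have fr k : fe (residue k) by case: (fill_inv k).
have [fs _] := spread_bounded n.
have fR := finite_excess_sum n fr.
have E1 := orbit_sumS ecA n ff.
have E2 := ec_ae ecA (finite_excess_orbit_sum ecA n ff) (finite_excessD fR fs) IHn.
have E3 := ec_add ecA fR fs.
have E4 := ec_sum ecA n fr.
apply: filterS2 (filterI E1 E2) (filterI E3 E4) => x [-> ->] [-> ->] /=.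
(* The increments of the deposits telescope to [deposit n], because [deposit 0] vanishes. *)
under eq_bigr do rewrite operator_residue.
rewrite big_split/= -(big_mkord xpredT (fun i => deposit i.+1 x - deposit i x)).
rewrite telescope_sumr// big_ord_recl/= [deposit 0 x]/(0) subr0.
have -> : residue 0 x = f x - clip a (f x) by [].
rewrite -[\sum_(i < n) residue (bump 0 i) x]/(\sum_(i < n) residue i.+1 x); lra.
Qed.

Lemma maximal_inequality_finite : exists B : set T, [/\ measurable B,
  (a%:E * mu B <= excess f a + excess f a)%E &
  \forall x \ae mu, ~ B x -> forall n, `|avg f n x| <= 3 * a].
Proof.
have m2 : measurable [set x | a + a <= `|f x|].
  apply: measurable_set_bool; apply: measurable_fun_ler => //.
  by apply: measurableT_comp => //; exact: ff.1.
have mF : measurable (\bigcup_n [set x | a <= filled n x]).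
  by apply: bigcup_measurable => n _; exact: measurable_full.
(* The second set governs [residue j] for j >= 1 only. The first one keeps [residue 0], the part of
   f above a, below a. *)
exists ([set x | a + a <= `|f x|] `|` \bigcup_n [set x | a <= filled n x]); split.
- exact: measurableU.
- apply: le_trans (lee_wpmul2l _ (measureU2 mu m2 mF)) _; first by rewrite lee_fin.
  rewrite ge0_muleDr// leeD//; last exact: measure_full.
  by apply: excess_markov => //; exact: ff.1.
- have H1 := ae_foralln (fun n => (spread_bounded n).2).
  have H2 := ae_foralln orbit_sum_residue.
  apply: filterS2 H1 H2 => x Zx Sx Bx n; have {}Zx := Zx n; have {}Sx := Sx n.
  have fx : `|f x| <= a + a by rewrite leNgt; apply/negP => /ltW fx; apply: Bx; left.
  have r0 j : residue j.+1 x = 0.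
    apply: residue_eq0; rewrite ltNge; apply/negP => Dx; apply: Bx; right.
    by exists j.+1.
  case: n => [|n] in Zx Sx *; first by rewrite /ergodic_average big_ord0 mulr0 normr0 mulr_ge0.
  rewrite /ergodic_average -/(orbit_sum A f n.+1 x) Sx normrM normfV normr_nat.
  rewrite ler_pdivrMl// big_ord_recl big1 ?addr0; last by move=> j _; exact: r0.
  (* The constant 3: the orbit sum of length n is at most a + n (2 a), and a <= n a. *)
  have rx : `|residue 0 x| <= a.
    have -> : residue 0 x = f x - clip a (f x) by [].
    by rewrite norm_sub_clip// ge_max a_ge0 andbT lerBlDr.
  have na : a <= n.+1%:R * a by rewrite ler_peMl// ler1n.
  rewrite (le_trans (ler_normD _ _))// (le_trans (lerD rx Zx))//.
  by rewrite (le_trans (lerD na (lexx _)))// -mulrDr; lra.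
Qed.

End maximal_inequality.

Lemma maximal_inequality d (T : measurableType d) (R : realType)
    (mu : {measure set T -> \bar R}) (A : (T -> R) -> T -> R) f (a : R) :
  excess_contraction mu A -> finite_excess mu f -> 0 < a ->
  exists B : set T, [/\ measurable B,
    (a%:E * mu B <= excess mu f a + excess mu f a)%E &
    \forall x \ae mu, ~ B x -> forall n, `|ergodic_average A f n x| <= 3 * a].
Proof.
move=> ecA ff a0; have [fa|] := ltP (excess mu f a) +oo%E.
  exact: maximal_inequality_finite.
rewrite leye_eq => /eqP ->; exists setT; split=> //; first by rewrite leey.
by apply: aeW => x /(_ I).
Qed.

(** * Layer-cake comparison of integrals *)

Section layer_cake.
Context {R : realType}.
Implicit Types (P G : R -> R -> R) (y l h : R).

(* [P y] is minus the derivative of [G y]; stating it with one-step differences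
   makes the Riemann sums below telescope and allows a discontinuous [P]. *)
Record layer P G : Prop := {
  layer_ge0 : forall y l, 0 <= P y l ;
  layer_G_ge0 : forall y l, 0 <= G y l ;
  layer_G_eq0 : forall y l, y <= l -> G y l = 0 ;
  layer_le : forall y l h, 0 <= l -> 0 < h -> h * P y (l + h) <= G y l - G y (l + h) ;
  layer_ge : forall y l h, 0 <= l -> 0 < h -> G y l - G y (l + h) <= h * P y l ;
  layer_cvg : forall y, 0 <= y -> G y (n.+1%:R^-1) @[n --> \oo] --> G y 0 ;
  layer_meas : forall l, measurable_fun setT (P^~ l) ;
  layer_G_meas : measurable_fun setT (G^~ 0) }.

(** The Riemann sum of [P y] over ]0, n+1] with mesh 1/(n+1), taken at right endpoints; hence the
    (n+1)^2 cells. *)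
Definition layer_sum P (n : nat) y :=
  \sum_(k < n.+1 ^ 2) n.+1%:R^-1 * P y (k.+1%:R * n.+1%:R^-1).

Lemma layer_sum_le P G n y : layer P G -> layer_sum P n y <= G y 0.
Proof.
move=> PG; set h : R := n.+1%:R^-1.
have h0 : 0 < h by rewrite invr_gt0.
apply: (@le_trans _ _ (\sum_(k < n.+1 ^ 2) (G y (k%:R * h) - G y (k.+1%:R * h)))).
  apply: ler_sum => k _; rewrite -[k.+1%:R]natr1 mulrDl mul1r.
  by apply: layer_le => //; rewrite mulr_ge0// ltW.
rewrite -(big_mkord xpredT (fun k => G y (k%:R * h) - G y (k.+1%:R * h))).
rewrite (@telescope_sumr_eq _ _ _ (fun k => - G y (k%:R * h)))//; last first.
  by move=> k _; rewrite opprK addrC.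
by rewrite mul0r opprK addrC gerDl oppr_le0; exact: layer_G_ge0 PG _ _.
Qed.

Lemma layer_sum_ge P G n y : layer P G -> y <= n.+1%:R ->
  G y n.+1%:R^-1 <= layer_sum P n y.
Proof.
move=> PG yn; set h : R := n.+1%:R^-1.
have h0 : 0 < h by rewrite invr_gt0.
apply: (@le_trans _ _ (\sum_(k < n.+1 ^ 2) (G y (k.+1%:R * h) - G y (k.+2%:R * h)))); last first.
  apply: ler_sum => k _; rewrite -[k.+2%:R]natr1 mulrDl mul1r.
  by apply: layer_ge => //; rewrite mulr_ge0// ltW.
rewrite -(big_mkord xpredT (fun k => G y (k.+1%:R * h) - G y (k.+2%:R * h))).
rewrite (@telescope_sumr_eq _ _ _ (fun k => - G y (k.+1%:R * h)))//; last first.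
  by move=> k _; rewrite opprK addrC.
(* The shifted grid ends at n+1+h, which lies beyond y. *)
have -> : G y ((n.+1 ^ 2).+1%:R * h) = 0.
  apply: (layer_G_eq0 PG); apply: (le_trans yn).
  rewrite -[(n.+1 ^ 2).+1%:R]natr1 mulrDl natrX expr2 -mulrA divff// mulr1.
  by rewrite lerDl mul1r ltW.
by rewrite oppr0 add0r opprK mul1r.
Qed.

Lemma layer_sum_cvg P G y : layer P G -> 0 <= y ->
  layer_sum P n y @[n --> \oo] --> G y 0.
Proof.
move=> PG y0; apply: (@squeeze_cvgr _ _ _ _ (fun n => G y n.+1%:R^-1) (fun=> G y 0)).
- near=> n; rewrite (layer_sum_le _ _ PG) andbT; apply: layer_sum_ge => //.
  apply: (@le_trans _ _ n%:R); last by rewrite ler_nat.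
  by near: n; exact: nbhs_infty_ger.
- exact: (layer_cvg PG y0).
- exact: cvg_cst.
Unshelve. all: by end_near. Qed.

Lemma integral_layer_sum d (T : measurableType d) (mu : {measure set T -> \bar R})
    P G n (f : T -> R) : layer P G -> measurable_fun setT f ->
  (\int[mu]_x (layer_sum P n (f x))%:E =
   \sum_(k < n.+1 ^ 2) n.+1%:R^-1%:E * \int[mu]_x (P (f x) (k.+1%:R * n.+1%:R^-1))%:E)%E.
Proof.
move=> PG mf.
have mP k : measurable_fun setT (fun x => P (f x) (k.+1%:R * n.+1%:R^-1)).
  exact: measurableT_comp (layer_meas PG _) mf.
under eq_integral do rewrite /layer_sum -sumEFin.
rewrite ge0_integral_sum//.
- apply: eq_bigr => k _; rewrite integral_EFinZ// => x; exact: layer_ge0 PG _ _.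
- by move=> k; apply/measurable_EFinP; exact: measurable_funM.
- by move=> k x _; rewrite lee_fin mulr_ge0//; exact: layer_ge0 PG _ _.
Qed.

(** The hypothesis compares the Riemann sums term by term. They converge to G, which allows Fatou's
    lemma on the left, and stay below G, which suffices on the right. [P1] and [P2] may be different
    derivatives of the same G. *)
Lemma layer_cake_le d1 (T1 : measurableType d1) (mu1 : {measure set T1 -> \bar R})
    d2 (T2 : measurableType d2) (mu2 : {measure set T2 -> \bar R})
    P1 P2 G (f1 : T1 -> R) (f2 : T2 -> R) :
  layer P1 G -> layer P2 G ->
  measurable_fun setT f1 -> measurable_fun setT f2 ->
  (forall x, 0 <= f1 x) -> (forall x, 0 <= f2 x) ->
  (forall l, (0 < l)%R ->
    \int[mu1]_x (P1 (f1 x) l)%:E <= \int[mu2]_x (P2 (f2 x) l)%:E)%E ->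
  (\int[mu1]_x (G (f1 x) 0)%:E <= \int[mu2]_x (G (f2 x) 0)%:E)%E.
Proof.
move=> PG1 PG2 mf1 mf2 f10 f20 P12.
have mS P n d (T : measurableType d) (f : T -> R) : layer P G ->
    measurable_fun setT f -> measurable_fun setT (fun x => layer_sum P n (f x)).
  move=> PG mf; apply: measurable_sum => k; apply: measurable_funM => //.
  exact: measurableT_comp (layer_meas PG _) mf.
have S0 P n y : layer P G -> 0 <= layer_sum P n y.
  by move=> PG; apply: sumr_ge0 => k _; rewrite mulr_ge0//; exact: layer_ge0 PG _ _.
apply: (@integral_limit_le _ _ _ mu1 (fun n x => layer_sum P1 n (f1 x))).
- by move=> n; exact: mS.
- exact: measurableT_comp (layer_G_meas PG1) mf1.
- by move=> n x; exact: S0.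
- by move=> x; exact: layer_G_ge0 PG1 _ _.
- by apply: aeW => x; exact: layer_sum_cvg.
- move=> n; apply: (@le_trans _ _ (\int[mu2]_x (layer_sum P2 n (f2 x))%:E)%E).
    rewrite (integral_layer_sum _ _ PG1)// (integral_layer_sum _ _ PG2)//.
    by apply: lee_sum => k _; rewrite lee_wpmul2l// ?lee_fin// P12// divr_gt0.
  apply: ae_le_integral_EFin => //.
  + exact: mS.
  + exact: measurableT_comp (layer_G_meas PG2) mf2.
  + by move=> x; exact: S0.
  + by move=> x; exact: layer_G_ge0 PG2 _ _.
  + by apply: aeW => x; exact: layer_sum_le.
Qed.

Lemma cvg_max0 (u : nat -> R) y : u n @[n --> \oo] --> y ->
  Num.max (u n) 0 @[n --> \oo] --> Num.max y 0.
Proof.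
move=> uy; rewrite maxr_absE; under eq_fun do rewrite maxr_absE.
rewrite !subr0 !addr0; under eq_fun do rewrite subr0 addr0.
by apply: cvgMl; apply: cvgD => //; exact: cvg_norm.
Qed.

Lemma cvg_max_sub_harmonic y :
  Num.max (y - n.+1%:R^-1) 0 @[n --> \oo] --> Num.max (y - 0) 0.
Proof. by apply: cvg_max0; apply: cvgB; [exact: cvg_cst|exact: cvg_harmonic]. Qed.

(** The integral of f^2 is the integral over all levels of twice the excess of f. *)
Lemma layer_square :
  layer (fun y l => 2 * Num.max (y - l) 0) (fun y l => Num.max (y - l) 0 ^+ 2).
Proof.
split.
- by move=> y l; rewrite mulr_ge0// le_max lexx orbT.
- by move=> y l; exact: sqr_ge0.
- by move=> y l yl; rewrite max_r ?expr0n// subr_le0.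
- move=> y l h l0 h0; case: (leP (y - l) 0) => ?; case: (leP (y - (l + h)) 0) => ?; nra.
- move=> y l h l0 h0; case: (leP (y - l) 0) => ?; case: (leP (y - (l + h)) 0) => ?; nra.
- by move=> y y0; under eq_fun do rewrite expr2; rewrite expr2; apply: cvgM; exact: cvg_max_sub_harmonic.
- move=> l; apply: measurable_funM => //; apply: measurable_maxr => //.
  exact: measurable_funB.
- apply: measurable_funX; apply: measurable_maxr => //; exact: measurable_funB.
Qed.

Lemma layer_ltr : layer (fun y l => (l < y)%R%:R) (fun y l => Num.max (y - l) 0).
Proof.
split.
- by [].
- by move=> y l; rewrite le_max lexx orbT.
- by move=> y l yl; rewrite max_r// subr_le0.
- move=> y l h l0 h0; case: (ltP (l + h) y) => ?;
  by case: (leP (y - l) 0) => ?; case: (leP (y - (l + h)) 0) => ?; rewrite ?mulr1 ?mulr0; lra.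
- move=> y l h l0 h0; case: (ltP l y) => ?;
  by case: (leP (y - l) 0) => ?; case: (leP (y - (l + h)) 0) => ?; rewrite ?mulr1 ?mulr0; lra.
- by move=> y y0; exact: cvg_max_sub_harmonic.
- move=> l; apply: (measurableT_comp (f := fun b : bool => b%:R : R)) => //.
  exact: measurable_fun_ltr.
- by apply: measurable_maxr => //; exact: measurable_funB.
Qed.

(** The same G as in [layer_ltr]: strict and weak level sets can thus be compared with each
    other. *)
Lemma layer_ler : layer (fun y l => (l <= y)%R%:R) (fun y l => Num.max (y - l) 0).
Proof.
split.
- by [].
- by move=> y l; rewrite le_max lexx orbT.
- by move=> y l yl; rewrite max_r// subr_le0.
- move=> y l h l0 h0; case: (leP (l + h) y) => ?;
  by case: (leP (y - l) 0) => ?; case: (leP (y - (l + h)) 0) => ?; rewrite ?mulr1 ?mulr0; lra.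
- move=> y l h l0 h0; case: (leP l y) => ?;
  by case: (leP (y - l) 0) => ?; case: (leP (y - (l + h)) 0) => ?; rewrite ?mulr1 ?mulr0; lra.
- by move=> y y0; exact: cvg_max_sub_harmonic.
- move=> l; apply: (measurableT_comp (f := fun b : bool => b%:R : R)) => //.
  exact: measurable_fun_ler.
- by apply: measurable_maxr => //; exact: measurable_funB.
Qed.

End layer_cake.

(** * Pointwise ergodic theorem *)

Section pointwise_convergence.
Context d (T : measurableType d) (R : realType) (mu : {measure set T -> \bar R}).
Variables (A : (T -> R) -> T -> R) (ecA : excess_contraction mu A).
Implicit Types (f g : T -> R) (a b : R).
Local Notation excess := (excess mu).
Local Notation fe := (finite_excess mu).
Local Notation avg := (ergodic_average A).

Definition avg_cvg f := \forall x \ae mu, cvgn (fun n => avg f n x).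

Lemma avg_cvgD f g : fe f -> fe g -> avg_cvg f -> avg_cvg g ->
  avg_cvg (fun x => f x + g x).
Proof.
move=> ff fg cf cg; apply: filterS (filterI (avgD ecA ff fg) (filterI cf cg)).
move=> x [fgx [cfx cgx]]; under eq_fun do rewrite fgx; exact: is_cvgD.
Qed.

Lemma avg_cvgZ c f : fe f -> avg_cvg f -> avg_cvg (fun x => c * f x).
Proof.
move=> ff cf; apply: filterS2 (avgZ ecA c ff) cf => x fx cfx.
by under eq_fun do rewrite fx; exact: is_cvgMr.
Qed.

Lemma avg_cvg_fixed f : fe f -> (\forall x \ae mu, A f x = f x) -> avg_cvg f.
Proof.
move=> ff Af; have : \forall x \ae mu, forall k, iter k A f x = f x.
  apply: ae_foralln; elim=> [|k IHk]; first exact: aeW.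
  have := ec_ae ecA (finite_excess_iter ecA k ff) ff IHk.
  by apply: filterS2 Af => x /= -> ->.
(* The average over no terms is 0, so the sequence is constant only from index 1 on. *)
apply: filterS => x Ax; apply/cvg_ex; exists (f x); rewrite -cvg_shiftS.
rewrite (_ : [sequence _]_n = fun=> f x); first exact: cvg_cst.
apply/funext => n; rewrite /ergodic_average /=.
under eq_bigr do rewrite Ax.
by rewrite sumr_const card_ord -[f x *+ _]mulr_natl mulKf.
Qed.

(** The orbit sum telescopes to f - A^n f, which is at most 2 a in modulus, so the averages tend to
    0. *)
Lemma avg_cvg_coboundary f a : fe f -> 0 <= a -> (\forall x \ae mu, `|f x| <= a) ->
  avg_cvg (fun x => f x - A f x).
Proof.
move=> ff a0 fa; have fAf := ec_stable ecA ff.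
apply: filterS2 (avgB ecA ff fAf) (iter_bounded ecA ff a0 fa) => x Bx fx.
apply/cvg_ex; exists 0; apply/norm_cvg0P.
apply: (@squeeze_cvgr _ _ _ _ (fun=> 0) (fun n => n%:R^-1 * (a + a))).
- apply: nearW => n; rewrite normr_ge0/= Bx /ergodic_average -mulrBr -sumrB.
  rewrite normrM normfV normr_nat ler_wpM2l ?invr_ge0//.
  under eq_bigr do rewrite -iterSr.
  rewrite -(big_mkord xpredT (fun k => iter k A f x - iter k.+1 A f x)).
  rewrite (@telescope_sumr_eq _ _ _ (fun k => - iter k A f x))//; last first.
    by move=> k _; rewrite opprK addrC.
  by rewrite opprK (le_trans (ler_normD _ _))// normrN lerD// (fx 0).
- exact: cvg_cst.
- rewrite -[X in _ --> X](mul0r (a + a)); apply: cvgMl.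
  by rewrite -cvg_shiftS; exact: cvg_harmonic.
Qed.

(* The bound on the excess holds when f - g is small in L^1, L^2 or L^oo. *)
Lemma avg_cvg_closed f : fe f ->
  (forall e, 0 < e -> exists g, [/\ fe g, avg_cvg g &
     (excess (fun x => f x - g x)%R e <= (e * e)%:E)%E]) ->
  avg_cvg f.
Proof.
move=> ff H.
have e_gt0 k : 0 < k.+1%:R^-1 :> R by rewrite invr_gt0.
(* With e = 1/(k+1), the 4 e is made of e for the convergent averages of g and of 3 e from the
   maximal inequality for f - g. *)
have /choice[B HB] : forall k, exists B : set T, [/\ measurable B,
    (mu B <= (2 * k.+1%:R^-1)%:E)%E & \forall x \ae mu, ~ B x ->
    exists l : R, \forall n \near \oo, `|l - avg f n x| < 4 * k.+1%:R^-1].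
  move=> k; set e : R := k.+1%:R^-1; have e0 : 0 < e by exact: e_gt0.
  have [g [fg cg fge]] := H e e0; have ffg := finite_excessB ff fg.
  have [B [mB muB BP]] := maximal_inequality ecA ffg e0; exists B; split=> //.
    rewrite -(@lee_pmul2l _ e%:E)//; apply: (le_trans muB).
    apply: le_trans (leeD fge fge) _; rewrite -EFinD -EFinM lee_fin; lra.
  apply: filterS (filterI BP (filterI cg (avgB ecA ff fg))) => x.
  move=> [fgx [/cvg_ex[l gl] Bx]] /fgx {}fgx; exists l.
  have : \forall n \near \oo, `|l - avg g n x| < e by exact: cvgr_dist_lt.
  apply: filterS => n gln; have := fgx n; rewrite Bx => fgn.
  rewrite (_ : l - _ = (l - avg g n x) - (avg f n x - avg g n x)); last by lra.
  by rewrite (le_lt_trans (ler_normB _ _))//; lra.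
(* It suffices that x avoids some [B j] beyond each k. The intersection of a tail lies in sets of
   arbitrarily small measure, hence is null. *)
have N0 : \forall x \ae mu, forall k, ~ (forall j, (k <= j)%N -> B j x).
  apply: ae_foralln => k; pose N := \bigcap_(j in [set j | (k <= j)%N]) B j.
  have mN : measurable N.
    by apply: bigcap_measurableType => j _; case: (HB j).
  exists N; split=> //; last by move=> x /= /contrapT.
  apply/eqP; rewrite eq_le measure_ge0 andbT; apply/lee_addgt0Pr => e e0.
  rewrite add0e; near \oo => n.
  have [mBn muBn _] := HB n.
  apply: (@le_trans _ _ (mu (B n))).
    apply: le_measure; rewrite ?inE// => x; apply => /=.
    by near: n; exact: nbhs_infty_ge.
  apply: (le_trans muBn); rewrite lee_fin -ler_pdivlMl//.
  near: n; have : 0 < 2^-1 * e by rewrite mulr_gt0.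
  move=> /(cvgr0_norm_le _ (@cvg_harmonic R)); apply: filterS => n /=.
  by rewrite ger0_norm// harmonic_ge0.
have HBx := ae_foralln (fun k => let: And3 _ _ h := HB k in h).
apply: filterS2 N0 HBx => x Nx HBx.
apply/cauchy_cvgP/cauchy_exP => e e0.
have [k ke] : exists k, 4 * k.+1%:R^-1 < e.
  near \oo => k; exists k; rewrite -ltr_pdivlMl//.
  near: k; have : 0 < 4^-1 * e by rewrite mulr_gt0.
  move=> /(cvgr0_norm_lt _ (@cvg_harmonic R)); apply: filterS => n /=.
  by rewrite ger0_norm// harmonic_ge0.
have /existsNP[j /not_implyP[kj Bj]] := Nx k.
have [l lP] := HBx j Bj; exists l; apply: filterS lP => n ln.
rewrite /ball/= /ball_ (lt_le_trans ln)// (le_trans _ (ltW ke))// ler_pM2l//.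
by rewrite lef_pV2 ?posrE// ler_nat.
Unshelve. all: by end_near. Qed.

End pointwise_convergence.

Section ae_limit.
Context d (T : measurableType d) (R : realType) (mu : {measure set T -> \bar R}).

(** Multiplication by the indicator of the complement of the exceptional set makes the sequence
    converge everywhere, so that its limit is measurable. *)
Lemma ae_cvg_measurable (g : nat -> T -> R) : (forall n, measurable_fun setT (g n)) ->
  (\forall x \ae mu, cvgn (g^~ x)) ->
  exists2 u : T -> R, measurable_fun setT u & \forall x \ae mu, g n x @[n --> \oo] --> u x.
Proof.
move=> mg [N [mN N0 gN]]; pose I x := ((x \in ~` N)%:R : R).
have mI : measurable_fun setT I.
  by apply: measurable_indic; exact: measurableC.
have cN x : ~ N x -> cvgn (g^~ x) by move=> Nx; apply: contrapT => cgx; exact/Nx/gN.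
have gIc x : I x * g n x @[n --> \oo] --> I x * limn (g^~ x).
  have [Nx|Nx] := pselect (N x).
    have -> : I x = 0 by rewrite /I memNset//= => /(_ Nx).
    by under eq_fun do rewrite mul0r; rewrite mul0r; exact: cvg_cst.
  by apply: cvgMr; exact: cN.
exists (fun x => I x * limn (g^~ x)).
  apply: (measurable_fun_cvg (h := fun n x => I x * g n x)) => // n.
  exact: measurable_funM.
exists N; split=> // x /= H; apply: contrapT => Nx; apply: H.
have I1 : I x = 1 by rewrite /I mem_set.
by rewrite I1 mul1r; exact: cN.
Qed.

End ae_limit.

(** * Square-integrable functions *)

Section square_integrable.
Context d (T : measurableType d) (R : realType) (mu : {measure set T -> \bar R}).
Implicit Types (f g : T -> R).
Local Notation excess := (excess mu).
Local Notation fe := (finite_excess mu).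

Definition sqint f := (\int[mu]_x (f x ^+ 2)%:E)%E.

Lemma sqint_ge0 f : (0 <= sqint f)%E.
Proof. by apply: integral_ge0 => x _; rewrite lee_fin sqr_ge0. Qed.

(** Expanding (|f| - e/2)^2 >= 0 gives |f| <= f^2 / e + e. *)
Lemma excess_le_sqint f e : measurable_fun setT f -> 0 < e ->
  (excess f e <= e^-1%:E * sqint f)%E.
Proof.
move=> mf e0; rewrite -integral_EFinZ//; [|exact: measurable_funX|by rewrite invr_ge0 ltW|
  by move=> x; exact: sqr_ge0].
apply: excess_le_integral => //.
- by apply: measurable_funM => //; exact: measurable_funX.
- by move=> x; rewrite mulr_ge0 ?sqr_ge0// invr_ge0 ltW.
- apply: aeW => x; rewrite -(ler_pM2l e0) mulrDr mulVKf ?gt_eqF// -[f x ^+ 2]real_normK ?num_real//.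
  have := sqr_ge0 (`|f x| - 2^-1 * e); have := sqr_ge0 e; rewrite !expr2; lra.
Qed.

Lemma finite_excess_sqint f : measurable_fun setT f -> (sqint f < +oo)%E -> fe f.
Proof.
move=> mf f2; split=> //; exists 1 => //.
by apply: le_lt_trans (excess_le_sqint mf ltr01) _; rewrite invr1 mul1e.
Qed.

Lemma sqint_parallelogram f g : measurable_fun setT f -> measurable_fun setT g ->
  (sqint (fun x => f x - g x)%R + sqint (fun x => f x + g x)%R =
   2%:E * sqint f + 2%:E * sqint g)%E.
Proof.
move=> mf mg; rewrite /sqint -!integral_EFinZ//;
  [|exact: measurable_funX|by move=> x; exact: sqr_ge0|exact: measurable_funX|by move=> x; exact: sqr_ge0].
rewrite -!integral_EFinD//; first by apply: eq_integral => x _; congr (_%:E); lra.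
- by apply: measurable_funM => //; exact: measurable_funX.
- by apply: measurable_funM => //; exact: measurable_funX.
- by move=> x; rewrite mulr_ge0 ?sqr_ge0.
- by move=> x; rewrite mulr_ge0 ?sqr_ge0.
- by apply: measurable_funX; exact: measurable_funB.
- by apply: measurable_funX; exact: measurable_funD.
- by move=> x; exact: sqr_ge0.
- by move=> x; exact: sqr_ge0.
Qed.

Lemma sqintZ c f : measurable_fun setT f ->
  sqint (fun x => c * f x) = ((c ^+ 2)%:E * sqint f)%E.
Proof.
move=> mf; rewrite /sqint -integral_EFinZ ?sqr_ge0//.
- by apply: eq_integral => x _; rewrite exprMn.
- exact: measurable_funX.
- by move=> x; exact: sqr_ge0.
Qed.

Lemma le_sqint f g : measurable_fun setT f -> measurable_fun setT g ->
  (\forall x \ae mu, `|f x| <= `|g x|) -> (sqint f <= sqint g)%E.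
Proof.
move=> mf mg fg; apply: ae_le_integral_EFin.
- exact: measurable_funX.
- exact: measurable_funX.
- by move=> x; exact: sqr_ge0.
- by move=> x; exact: sqr_ge0.
- by apply: filterS fg => x fgx; rewrite -[leLHS]real_normK ?num_real// -[leRHS]real_normK ?num_real// lerXn2r ?nnegrE.
Qed.

(** Interpolation between L^1 and L^oo, by integrating the excess inequality over all levels. *)
Lemma sqint_contraction (A : (T -> R) -> T -> R) f : excess_contraction mu A ->
  fe f -> (sqint (A f) <= sqint f)%E.
Proof.
move=> ecA ff; have fAf := ec_stable ecA ff.
have mn (g : T -> R) : measurable_fun setT g -> measurable_fun setT (fun x => `|g x|).
  by move=> mg; exact: measurableT_comp.
have := layer_cake_le (mu1 := mu) (mu2 := mu) layer_square layer_square
  (mn _ fAf.1) (mn _ ff.1) (fun x => normr_ge0 _) (fun x => normr_ge0 _).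
have sqE g : (\int[mu]_x (Num.max (`|g x| - 0) 0 ^+ 2)%:E)%E = sqint g.
  by apply: eq_integral => x _; rewrite subr0 max_l// real_normK ?num_real.
rewrite !sqE; apply => l l0.
rewrite !integral_EFinZ//; [|exact: measurable_excess ff.1|by move=> x; exact: max_sub_ge0|
   exact: measurable_excess fAf.1|by move=> x; exact: max_sub_ge0].
by rewrite lee_pmul2l//; apply: ec_excess => //; exact: ltW.
Qed.

Lemma geometric_half_sum n : \sum_(k < n) 2^-1 ^+ k = 2 - 2 * 2^-1 ^+ n :> R.
Proof.
elim: n => [|n IHn]; first by rewrite big_ord0 expr0 mulr1 subrr.
by rewrite big_ord_recr/= IHn exprS; lra.
Qed.

(** With h_n = 2^-n and increments D_n, the functions w_n = D_n^2 / h_n have integrals at most h_n,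
    so their sum is finite almost everywhere; and |D_n| <= h_n + w_n makes the increments absolutely
    summable there. *)
Lemma sqint_ae_cvg (g : nat -> T -> R) : (forall n, measurable_fun setT (g n)) ->
  (forall n, sqint (fun x => g n.+1 x - g n x)%R <= (2^-1 ^+ n * 2^-1 ^+ n)%:E)%E ->
  \forall x \ae mu, cvgn (g^~ x).
Proof.
move=> mg gh; pose h n : R := 2^-1 ^+ n.
have h0 n : 0 < h n by rewrite exprn_gt0.
pose D n x := g n.+1 x - g n x.
have mD n : measurable_fun setT (D n) by exact: measurable_funB.
pose w n x := (h n)^-1 * D n x ^+ 2.
have w0 n x : 0 <= w n x by rewrite mulr_ge0 ?sqr_ge0// invr_ge0 ltW.
have mw n : measurable_fun setT (w n).
  by apply: measurable_funM => //; exact: measurable_funX.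
have mEw n : measurable_fun setT (fun x => (w n x)%:E) by exact/measurable_EFinP.
have Ew0 n x : setT x -> (0 <= (w n x)%:E)%E by move=> _; rewrite lee_fin.
have Iw : (\int[mu]_x (\sum_(n <oo) (w n x)%:E) <= 2%:E)%E.
  rewrite integral_nneseries//; apply: lime_le.
    by apply: is_cvg_nneseries => n _ _; apply: integral_ge0 => x _; rewrite lee_fin.
  apply: nearW => n; rewrite big_mkord.
  apply: (@le_trans _ _ (\sum_(k < n) (h k)%:E)%E).
    apply: lee_sum => k _; rewrite integral_EFinZ//; [|exact: measurable_funX|
      by rewrite invr_ge0 ltW|by move=> x; exact: sqr_ge0].
    apply: (@le_trans _ _ ((h k)^-1%:E * (h k * h k)%:E)%E).
      by rewrite lee_wpmul2l ?gh// lee_fin invr_ge0 ltW.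
    by rewrite -EFinM mulKf// gt_eqF.
  rewrite sumEFin lee_fin geometric_half_sum gerBl mulr_ge0//; exact/ltW/h0.
have mS : measurable_fun setT (fun x => \sum_(n <oo) (w n x)%:E)%E.
  apply: (ge0_emeasurable_sum (P := xpredT)) => // k x _ _.
  by rewrite lee_fin.
have : mu.-integrable setT (fun x => \sum_(n <oo) (w n x)%:E)%E.
  apply/integrableP; split=> //; apply: le_lt_trans (ltry 2); apply: le_trans Iw.
  rewrite le_eqVlt; apply/orP; left; apply/eqP; apply: eq_integral => x _.
  by rewrite gee0_abs//; apply: nneseries_ge0 => n _ _; rewrite lee_fin.
move=> /(integrable_ae measurableT); apply: filterS => x /(_ I) Sx.
set S := (\sum_(n <oo) (w n x)%:E)%E in Sx.
have wS n : \sum_(k < n) w k x <= fine S.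
  rewrite -lee_fin fineK// -sumEFin -(big_mkord xpredT (fun k => (w k x)%:E)).
  by apply: nneseries_lim_ge => k _; rewrite lee_fin.
have Dw k : `|D k x| <= h k + w k x.
  rewrite -(ler_pM2l (h0 k)) mulrDr mulVKf ?gt_eqF//; rewrite -[D k x ^+ 2]real_normK ?num_real//.
  have := sqr_ge0 (`|D k x| - 2^-1 * h k); have := sqr_ge0 (h k); rewrite !expr2; lra.
have cD : cvgn (series (fun k => D k x)).
  apply: normed_cvg; rewrite /normed_series_of; apply: nondecreasing_is_cvgn.
    by apply/nondecreasing_seqP => n; rewrite !seriesEord/= big_ord_recr/= lerDl.
  exists (2 + fine S) => _ [n _ <-]; rewrite seriesEord/=.
  apply: (@le_trans _ _ (\sum_(k < n) (h k + w k x))); first exact: ler_sum.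
  rewrite big_split/= geometric_half_sum lerD ?wS//.
  by rewrite gerBl mulr_ge0//; exact/ltW/h0.
have cg : cvgn (fun n => g 0 x + series (fun k => D k x) n).
  by apply: is_cvgD; [exact: is_cvg_cst|exact: cD].
suff E : (fun n => g 0 x + series (fun k => D k x) n) = g^~ x by rewrite E in cg.
by apply/funext => n; rewrite seriesEnat/= telescope_sumr// subrKC.
Qed.

End square_integrable.

(** * Averages of bounded square-integrable functions *)

Section square_integrable_convergence.
Context d (T : measurableType d) (R : realType) (mu : {measure set T -> \bar R}).
Variables (A : (T -> R) -> T -> R) (ecA : excess_contraction mu A).
Local Notation excess := (excess mu).
Local Notation fe := (finite_excess mu).
Local Notation avg := (ergodic_average A).
Local Notation sqint := (sqint mu).

(** Midpoints stand in for general convex combinations, since they are what the parallelogram law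
    involves; the inductive form gives the properties of the elements by induction. *)
Inductive orbit_hull (f : T -> R) : (T -> R) -> Prop :=
| orbit_hull_base : orbit_hull f f
| orbit_hull_op g : orbit_hull f g -> orbit_hull f (A g)
| orbit_hull_mid g h : orbit_hull f g -> orbit_hull f h ->
    orbit_hull f (fun x => 2^-1 * (g x + h x)).

Variables (f : T -> R) (a : R).
Hypotheses (ff : fe f) (a0 : 0 <= a) (fa : \forall x \ae mu, `|f x| <= a).
Hypothesis f2 : (sqint f < +oo)%E.

Lemma sqint_mid (g h : T -> R) : measurable_fun setT g -> measurable_fun setT h ->
  (sqint (fun x => g x - h x)%R + 4%:E * sqint (fun x => 2^-1 * (g x + h x))%R =
   2%:E * sqint g + 2%:E * sqint h)%E.
Proof.
move=> mg mh; rewrite -sqint_parallelogram//; congr (_ + _)%E.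
rewrite sqintZ; last exact: measurable_funD.
by rewrite muleA -EFinM (_ : 4 * _ = 1) ?mul1e//; lra.
Qed.

(** For the last property, f - A g = (f - g) + (g - A g), where the second term is a coboundary of a
    bounded function. *)
Lemma orbit_hullP g : orbit_hull f g -> [/\ fe g, \forall x \ae mu, `|g x| <= a,
  (sqint g < +oo)%E & avg_cvg mu A (fun x => f x - g x)].
Proof.
elim=> {g} [|g _ [fg ga g2 cg]|g h _ [fg ga g2 cg] _ [fh ha h2 ch]].
- split=> //; under eq_fun do rewrite subrr.
  have c0 := @avg_cvg_fixed _ _ _ mu A ecA (fun=> 0) (finite_excess_cst mu 0).
  apply: c0; apply: filterS (ec_scale ecA 0 (finite_excess_cst mu 0)) => x.
  move=> A0x; rewrite -[RHS](mul0r (A (fun=> 0) x)) -A0x; congr (A _ x).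
  by apply/funext => y; rewrite mul0r.
- have fAg := ec_stable ecA fg; split=> //.
  + exact: (ec_bounded ecA).
  + exact: le_lt_trans (sqint_contraction ecA fg) g2.
  + have -> : (fun x => f x - A g x) = (fun x => (f x - g x) + (g x - A g x)).
      by apply/funext => x; rewrite addrA subrK.
    apply: (avg_cvgD ecA) => //; [exact: finite_excessB|exact: finite_excessB|].
    exact: (avg_cvg_coboundary ecA fg a0 ga).
- split.
  + by apply: finite_excessZ; exact: finite_excessD.
  + apply: filterS2 ga ha => x gx hx; rewrite normrM ger0_norm//.
    by rewrite ler_pdivrMl// (le_trans (ler_normD _ _))//; lra.
  + apply: (@le_lt_trans _ _ (2%:E * sqint g + 2%:E * sqint h)%E).
      rewrite -(sqint_mid fg.1 fh.1).
      apply: le_trans (leeDr _ (sqint_ge0 mu _)).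
      by rewrite -[leLHS]mul1e lee_wpmul2r ?sqint_ge0// lee_fin ler1n.
    by rewrite lte_add_pinfty// lte_mul_pinfty.
  + rewrite [X in avg_cvg mu A X](_ : _ =
        (fun x => 2^-1 * (f x - g x) + 2^-1 * (f x - h x))); last first.
      by apply/funext => x; lra.
    have fgB := finite_excessB ff fg; have fhB := finite_excessB ff fh.
    by apply: (avg_cvgD ecA); [exact: finite_excessZ|exact: finite_excessZ|
      exact: avg_cvgZ|exact: avg_cvgZ].
Qed.

(* Riesz's argument: elements of the convex set [orbit_hull f] that nearly
   minimize the L^2 norm are close to each other by the parallelogram law, and
   the set is stable under A, so they are also nearly fixed by A. *)
Lemma orbit_hull_minimizing : exists g : nat -> T -> R,
  [/\ forall n, orbit_hull f (g n),
    (forall m n, (n <= m)%N ->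
      sqint (fun x => g n x - g m x)%R <= (2^-1 ^+ n * 2^-1 ^+ n)%:E)%E &
    (forall n, sqint (fun x => A (g n) x - g n x)%R <= (2^-1 ^+ n * 2^-1 ^+ n)%:E)%E].
Proof.
pose q g := fine (sqint g).
have qE g : orbit_hull f g -> sqint g = (q g)%:E.
  by case/orbit_hullP => _ _ g2 _; rewrite fineK// ge0_fin_numE// sqint_ge0.
pose D := [set q g | g in orbit_hull f].
have D0 : has_inf D.
  split; first by exists (q f), f => //; exact: orbit_hull_base.
  by exists 0 => _ [g _ <-]; rewrite fine_ge0// sqint_ge0.
(* The midpoint has squared norm at least the infimum, so the parallelogram law leaves 2 (q g + q h)
   - 4 inf D <= 4 e. *)
have close g h e : orbit_hull f g -> orbit_hull f h ->
    q g <= inf D + e -> q h <= inf D + e ->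
    (sqint (fun x => g x - h x)%R <= (4 * e)%:E)%E.
  move=> Hg Hh ge he.
  have [[mg _] _ _ _] := orbit_hullP Hg; have [[mh _] _ _ _] := orbit_hullP Hh.
  have Hm := orbit_hull_mid Hg Hh.
  have := sqint_mid mg mh; rewrite (qE g)// (qE h)// (qE _ Hm) -!EFinM -EFinD.
  have dm : inf D <= q (fun x => 2^-1 * (g x + h x)).
    by apply: ge_inf; [case: D0|exists (fun x => 2^-1 * (g x + h x))].
  case: (sqint (fun x => g x - h x)) => [r [rE]|//|//].
  by rewrite lee_fin; lra.
(* The factor 1/4 absorbs the 4 of [close]. *)
pose e n : R := 4^-1 * (2^-1 ^+ n * 2^-1 ^+ n).
have e0 n : 0 < e n by rewrite !mulr_gt0// exprn_gt0.
have /choice[g gP] : forall n, exists g, orbit_hull f g /\ q g <= inf D + e n.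
  move=> n; have [_ [g Hg <-] ge] := inf_adherent (e0 n) D0.
  by exists g; split=> //; exact: ltW.
have eE n : 4 * e n = 2^-1 ^+ n * 2^-1 ^+ n by rewrite /e mulVKf.
exists g; split.
- by move=> n; case: (gP n).
- move=> m n nm; rewrite -eE.
  have [Hn qn] := gP n; have [Hm qm] := gP m; apply: close => //.
  apply: (le_trans qm); rewrite lerD2l /e ler_pM2l//.
  have hmn : 2^-1 ^+ m <= 2^-1 ^+ n :> R by rewrite ler_wiXn2l// invf_le1// ler1n.
  by apply: ler_pM => //; rewrite exprn_ge0.
(* [A] does not increase the L^2 norm, so [A (g n)] is as nearly minimizing as [g n]. *)
- move=> n; rewrite -eE; have [Hn qn] := gP n; apply: close => //.
    exact: orbit_hull_op.
  apply: le_trans qn; rewrite -lee_fin -(qE _ Hn) -(qE _ (orbit_hull_op Hn)).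
  by apply: sqint_contraction => //; case: (orbit_hullP Hn).
Qed.

(** With u the limit of the minimizing sequence, f = (f - g n) + u + (g n - u): the averages of the
    first term converge, u is fixed, and the last term is small in L^2. *)
Lemma avg_cvg_sqint : avg_cvg mu A f.
Proof.
have [g [Hg gC gA]] := orbit_hull_minimizing.
pose h n : R := 2^-1 ^+ n.
have h0 n : 0 < h n by rewrite exprn_gt0.
have h_le1 n : h n <= 1 by rewrite /h exprn_ile1// invf_le1// ler1n.
have hh_le n : h n * h n <= h n by rewrite ler_piMr// ltW.
have h_cvg0 : h @ \oo --> 0 by apply: cvg_expr; rewrite ger0_norm// invf_lt1// ltr1n.
have fg n : fe (g n) by case: (orbit_hullP (Hg n)).
have mg n : measurable_fun setT (g n) by exact: (fg n).1.
have [u mu_ gu] : exists2 u : T -> R, measurable_fun setT u &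
    \forall x \ae mu, g n x @[n --> \oo] --> u x.
  apply: ae_cvg_measurable => //; apply: (sqint_ae_cvg mg) => n.
  apply: le_trans (gC n.+1 n (leqnSn n)); apply: le_sqint.
  - exact: measurable_funB.
  - exact: measurable_funB.
  - by apply: aeW => x; rewrite distrC.
have gu2 n : (sqint (fun x => g n x - u x)%R <= (h n * h n)%:E)%E.
  apply: (@integral_limit_le _ _ _ mu (fun m x => (g n x - g (m + n) x) ^+ 2)).
  - by move=> m; apply: measurable_funX; exact: measurable_funB.
  - by apply: measurable_funX; exact: measurable_funB.
  - by move=> m x; exact: sqr_ge0.
  - by move=> x; exact: sqr_ge0.
  - apply: filterS gu => x gux; under eq_fun do rewrite expr2; rewrite expr2.
    have H : g n x - g (m + n) x @[m --> \oo] --> g n x - u x.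
      apply: cvgB; first exact: cvg_cst.
      by rewrite (cvg_shiftn n (fun m => g m x)).
    exact: cvgM.
  - by move=> m; apply: gC; rewrite leq_addl.
have fgu n : fe (fun x => g n x - u x).
  apply: finite_excess_sqint; first exact: measurable_funB.
  by apply: le_lt_trans (gu2 n) _; rewrite ltry.
have fu : fe u.
  have -> : u = (fun x => g 0 x - (g 0 x - u x)) by apply/funext => x; rewrite subKr.
  exact: finite_excessB.
have fAu := ec_stable ecA fu.
have Agu n : (sqint (fun x => A (g n) x - A u x)%R <= (h n * h n)%:E)%E.
  apply: le_trans (gu2 n); apply: le_trans (sqint_contraction ecA (fgu n)).
  have fAgn := ec_stable ecA (fg n).
  apply: le_sqint.
  - by apply: measurable_funB; [exact: fAgn.1|exact: fAu.1].
  - exact: (ec_stable ecA (fgu n)).1.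
  - have E1 := ec_scale ecA (-1) fu.
    have E2 := ec_add ecA (fg n) (finite_excessZ (-1) fu).
    apply: filterS2 E1 E2 => x E1 E2.
    rewrite [X in _ <= `|X|](_ : _ = A (g n) x + A (fun y => -1 * u y) x).
      by rewrite E1 mulN1r.
    by rewrite -E2; congr (A _ x); apply/funext => y; rewrite mulN1r.
have Au : \forall x \ae mu, A u x = u x.
  have : sqint (fun x => A u x - u x) = 0%E.
    apply/eqP; rewrite eq_le sqint_ge0 andbT; apply/lee_addgt0Pr => e e0; rewrite add0e.
    (* A u - u is a signed sum of three functions, each with square integral at most (h n)^2 <= h n,
       and the square of a sum of three terms is at most 3 times the sum of their squares. *)
    have [n hn] : exists n, 9 * h n < e.
      near \oo => n; exists n; rewrite -ltr_pdivlMl//.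
      near: n; have : 0 < 9^-1 * e by rewrite mulr_gt0.
      move=> /(cvgr0_norm_lt _ h_cvg0); apply: filterS => n /=.
      by rewrite ger0_norm// ltW.
    have mX := measurable_funX 2.
    have fAgn := ec_stable ecA (fg n).
    pose F x := (A (g n) x - A u x) ^+ 2; pose G x := (A (g n) x - g n x) ^+ 2.
    pose H x := (g n x - u x) ^+ 2.
    have mF : measurable_fun setT F.
      by apply: mX; apply: measurable_funB; [exact: fAgn.1|exact: fAu.1].
    have mG : measurable_fun setT G by apply: mX; apply: measurable_funB => //; exact: fAgn.1.
    have mH : measurable_fun setT H by apply: mX; exact: measurable_funB.
    apply: (@le_trans _ _ (\int[mu]_x (3 * (F x + (G x + H x)))%:E)%E).
      apply: ae_le_integral_EFin.
      + by apply: mX; apply: measurable_funB => //; exact: fAu.1.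
      + by apply: measurable_funM => //; apply: measurable_funD => //; exact: measurable_funD.
      + by move=> x; exact: sqr_ge0.
      + by move=> x; rewrite mulr_ge0// !addr_ge0 ?sqr_ge0.
      (* The right side minus the left side is the sum of the three squares below. *)
      + apply: aeW => x; rewrite /F /G /H; set p := A u x; set r := A (g n) x.
        have := sqr_ge0 ((r - p) + (r - g n x)); have := sqr_ge0 ((r - p) - (u x - g n x)).
        have := sqr_ge0 ((r - g n x) + (u x - g n x)); rewrite !expr2; lra.
    have F0 x : 0 <= F x by exact: sqr_ge0.
    have G0 x : 0 <= G x by exact: sqr_ge0.
    have H0 x : 0 <= H x by exact: sqr_ge0.
    have GH0 x : 0 <= G x + H x by rewrite addr_ge0.
    rewrite integral_EFinZ//; last 2 first.
      by apply: measurable_funD => //; exact: measurable_funD.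
      by move=> x; rewrite addr_ge0.
    rewrite integral_EFinD//; last exact: measurable_funD.
    rewrite integral_EFinD//.
    apply: (@le_trans _ _ (3%:E * ((h n * h n)%:E + ((h n * h n)%:E + (h n * h n)%:E)))%E).
      by rewrite lee_pmul2l//; apply: leeD; [exact: Agu|apply: leeD; [exact: gA|exact: gu2]].
    by have := hh_le n; rewrite -!EFinD -EFinM lee_fin; lra.
  move=> S0.
  have : (\int[mu]_x `|((A u x - u x) ^+ 2)%:E| = 0)%E.
    by rewrite -S0; apply: eq_integral => x _; rewrite abse_EFin ger0_norm// sqr_ge0.
  move/ae_eq_integral_abs => /(_ measurableT).
  have mE : measurable_fun setT (fun x => ((A u x - u x) ^+ 2)%:E).
    by apply/measurable_EFinP/measurable_funX/measurable_funB => //; exact: fAu.1.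
  move=> /(_ mE); apply: filterS => x /(_ I) [] /eqP.
  by rewrite sqrf_eq0 subr_eq0 => /eqP.
apply: (avg_cvg_closed ecA ff) => e e0.
(* Passing from the square integral to the excess over e costs a factor 1/e, and the excess must be
   at most e^2; hence the cube. *)
have [n hn] : exists n, h n * h n < e * (e * e).
  near \oo => n; exists n.
  apply: le_lt_trans (hh_le n) _.
  near: n; have : 0 < e * (e * e) by rewrite !mulr_gt0.
  move=> /(cvgr0_norm_lt _ h_cvg0); apply: filterS => n /=.
  by rewrite ger0_norm// ltW.
exists (fun x => (f x - g n x) + u x); split.
- by apply: finite_excessD => //; exact: finite_excessB.
- apply: (avg_cvgD ecA) => //; first exact: finite_excessB.
    by case: (orbit_hullP (Hg n)).
  exact: avg_cvg_fixed.
- have -> : (fun x => f x - (f x - g n x + u x)) = (fun x => g n x - u x).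
    by apply/funext => x; lra.
  apply: le_trans (excess_le_sqint mu (fgu n).1 e0) _.
  apply: (@le_trans _ _ (e^-1%:E * (h n * h n)%:E)%E).
    by rewrite lee_wpmul2l// lee_fin invr_ge0 ltW.
  by rewrite -EFinM lee_fin ler_pdivrMl// ltW.
Unshelve. all: by end_near. Qed.

End square_integrable_convergence.

(** * From bounded square-integrable functions to level sets of finite measure *)

Section pointwise_ergodic_theorem.
Context d (T : measurableType d) (R : realType) (mu : {measure set T -> \bar R}).
Variables (A : (T -> R) -> T -> R) (ecA : excess_contraction mu A).
Local Notation excess := (excess mu).
Local Notation fe := (finite_excess mu).
Local Notation sqint := (sqint mu).

Lemma cvg_excess0 (f : T -> R) : measurable_fun setT f -> (excess f 0 < +oo)%E ->
  excess f n%:R @[n --> \oo] --> 0%E.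
Proof.
move=> mf f1.
have intf : mu.-integrable setT (fun x => `|f x|%:E).
  apply/integrableP; split; first by apply/measurable_EFinP; exact: measurableT_comp.
  by rewrite excess0 in f1; under eq_integral do rewrite abse_EFin normr_id.
have [] := @dominated_convergence _ _ _ mu setT measurableT
  (fun n x => (Num.max (`|f x| - n%:R) 0)%:E) (cst 0%E) (fun x => `|f x|%:E).
- by move=> n; apply/measurable_EFinP; exact: measurable_excess.
- exact: measurable_cst.
- apply: aeW => x _; apply: cvg_near_cst; near=> n.
  rewrite max_r// subr_le0; near: n; exact: nbhs_infty_ger.
- exact: intf.
- apply: aeW => x n _; rewrite abse_EFin lee_fin ger0_norm ?max_sub_ge0//.
  by apply: max_sub_le => //; rewrite lerDl.
by move=> _ _; rewrite integral0.
Unshelve. all: by end_near. Qed.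

(** Truncation at height n gives a bounded function whose square integral is at most n times the L^1
    norm of f, and its L^1 distance to f is the excess over n, which tends to 0. *)
Lemma avg_cvg_integrable f : measurable_fun setT f -> (excess f 0 < +oo)%E ->
  avg_cvg mu A f.
Proof.
move=> mf f1; have ff : fe f by split => //; exists 0.
apply: (avg_cvg_closed ecA ff) => e e0.
have [n fn] : exists n, (excess f n%:R <= (e * e)%:E)%E.
  near \oo => n; exists n; near: n.
  have ee : 0 < e * e by rewrite mulr_gt0.
  have /fine_cvgP[fin /cvgr0_norm_lt/(_ _ ee)] := cvg_excess0 mf f1.
  apply: filterS2 fin => n fn /=; rewrite ger0_norm ?fine_ge0 ?excess_ge0// => fe.
  by rewrite -(fineK fn) lee_fin ltW.
have mc : measurable_fun setT (fun x => clip n%:R (f x)) by exact: measurable_clip.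
have fc : \forall x \ae mu, `|clip n%:R (f x)| <= n%:R.
  by apply: aeW => x; exact: norm_clip_le.
have fec := finite_excess_bounded mc fc.
exists (fun x => clip n%:R (f x)); split=> //.
- apply: (@avg_cvg_sqint _ _ _ mu A ecA _ n%:R) => //.
  apply: (@le_lt_trans _ _ (n%:R%:E * excess f 0)%E); last by rewrite lte_mul_pinfty.
  rewrite excess0 -integral_EFinZ//; last exact: measurableT_comp.
  apply: ae_le_integral_EFin => //.
  + exact: measurable_funX.
  + by apply: measurable_funM => //; exact: measurableT_comp.
  + by move=> x; exact: sqr_ge0.
  + apply: aeW => x; rewrite -[leLHS]real_normK ?num_real// expr2.
    by apply: ler_pM => //; rewrite norm_clip// ge_min lexx ?orbT.
- apply: le_trans fn; rewrite -(excess_sub_clip mu mf (ler0n _ n)).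
  apply: excess_nonincreasing; last exact: ltW.
  exact: measurable_funB.
Unshelve. all: by end_near. Qed.

Theorem pointwise_ergodic f : fe f ->
  (forall l : R, 0 < l -> (mu [set x | (l < `|f x|)%R] < +oo)%E) -> avg_cvg mu A f.
Proof.
move=> ff fl; have [mf [a a0 fa]] := ff.
apply: (avg_cvg_closed ecA ff) => e e0.
(* Where |f| > e, the excess over e costs at most a more than that over a, and this happens on a set
   of finite measure. *)
have fee : (excess f e < +oo)%E.
  pose I x := ((e < `|f x|)%R%:R : R).
  have mI : measurable_fun setT I.
    apply: (measurableT_comp (f := fun b : bool => b%:R : R)) => //.
    by apply: measurable_fun_ltr => //; exact: measurableT_comp.
  have me := measurable_excess a mf.
  apply: (@le_lt_trans _ _ (\int[mu]_x (Num.max (`|f x| - a) 0 + a * I x)%:E)%E).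
    apply: excess_le_integral => //.
    - by apply: measurable_funD => //; exact: measurable_funM.
    - by move=> x; rewrite addr_ge0 ?max_sub_ge0// mulr_ge0.
    - apply: aeW => x; rewrite /I; case: ltP => fx; rewrite ?mulr1 ?mulr0.
        by rewrite (le_trans (le_max_sub _ a))// lerDl ltW.
      by rewrite (le_trans fx)// lerDr addr0 max_sub_ge0.
  rewrite integral_EFinD//; [|exact: measurable_funM|by move=> x; exact: max_sub_ge0|
    by move=> x; rewrite mulr_ge0].
  rewrite lte_add_pinfty// integral_EFinZ// lte_mul_pinfty//.
  apply: le_lt_trans (fl e e0).
  have mS : measurable [set x | e < `|f x|].
    by apply: measurable_set_bool; apply: measurable_fun_ltr => //; exact: measurableT_comp.
  rewrite -[X in (_ <= mu X)%E]setIT -integral_indic//.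
  rewrite le_eqVlt; apply/orP; left; apply/eqP; apply: eq_integral => x _.
  by rewrite indicE; congr ((nat_of_bool _)%:R%:E); apply/idP/idP; rewrite inE.
have mr : measurable_fun setT (fun x => f x - clip e (f x)).
  by apply: measurable_funB => //; exact: measurable_clip.
have r1 : (excess (fun x => f x - clip e (f x))%R 0%R < +oo)%E.
  by rewrite excess_sub_clip//; exact: ltW.
(* This part is integrable by [fee], and what remains is bounded by e, so its excess over e
   vanishes. *)
exists (fun x => f x - clip e (f x)); split.
- by split=> //; exists 0.
- exact: avg_cvg_integrable.
- have -> : (fun x => f x - (f x - clip e (f x))) = (fun x => clip e (f x)).
    by apply/funext => x; rewrite subKr.
  rewrite (excess_eq0 mu _ (measurable_clip e mf)).1 ?lee_fin ?mulr_ge0// ?ltW//.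
  by apply: aeW => x; exact/norm_clip_le/ltW.
Qed.

End pointwise_ergodic_theorem.

(** * Rearrangements *)

Lemma integral_bool d (T : measurableType d) (R : realType) (mu : {measure set T -> \bar R})
    (b : T -> bool) : measurable_fun setT b ->
  (\int[mu]_x ((b x)%:R : R)%:E = mu [set x | b x])%E.
Proof.
move=> mb; have mS := measurable_set_bool mb.
rewrite -[X in _ = mu X]setIT -integral_indic//; apply: eq_integral => x _.
by rewrite indicE; congr ((nat_of_bool _)%:R%:E); apply/idP/idP; rewrite inE.
Qed.


(** The level sets are strict on one side and weak on the other, because an infimum such as the
    rearrangement yields only weak inequalities. *)
Lemma le_integral_levels (R : realType) d1 (T1 : measurableType d1)
    (mu1 : {measure set T1 -> \bar R}) d2 (T2 : measurableType d2)
    (mu2 : {measure set T2 -> \bar R}) (f1 : T1 -> R) (f2 : T2 -> R) :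
  measurable_fun setT f1 -> measurable_fun setT f2 ->
  (forall x, 0 <= f1 x) -> (forall x, 0 <= f2 x) ->
  (forall r : R, 0 < r ->
    (mu1 [set x | (r < f1 x)%R] <= mu2 [set x | (r <= f2 x)%R])%E) ->
  (\int[mu1]_x (f1 x)%:E <= \int[mu2]_x (f2 x)%:E)%E.
Proof.
move=> mf1 mf2 f10 f20 f12.
have GE d (T : measurableType d) (mu : {measure set T -> \bar R}) (f : T -> R) :
    (forall x, 0 <= f x) ->
    (\int[mu]_x (f x)%:E = \int[mu]_x (Num.max (f x - 0) 0)%:E)%E.
  by move=> f0; apply: eq_integral => x _; rewrite subr0 max_l.
rewrite (GE _ _ _ f1)// (GE _ _ _ f2)//.
apply: (layer_cake_le layer_ltr layer_ler) => // r r0.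
rewrite (integral_bool mu1 (b := fun x => (r < f1 x)%R)); last exact: measurable_fun_ltr.
rewrite (integral_bool mu2 (b := fun x => (r <= f2 x)%R)); last exact: measurable_fun_ler.
exact: f12.
Qed.

Section rearrangement.
Context d (T : measurableType d) (R : realType) (mu : {measure set T -> \bar R}).
Context (K : numFieldType) (md : K -> R).
Hypothesis md_ge0 : forall z, 0 <= md z.
Implicit Types (f g : T -> K) (s t l : R).
Local Notation rearr := (rearrangement mu md).
Local Notation leb := (@lebesgue_measure R).

Lemma rearrangement_ge0 f t : (0 <= rearr f t)%E.
Proof.
by apply: le_ereal_inf_tmp => _ [l [l0 _] <-]; rewrite lee_fin ltW.
Qed.

Lemma rearrangement_nonincreasing f t1 t2 : t1 <= t2 -> (rearr f t2 <= rearr f t1)%E.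
Proof.
move=> t12; apply: ereal_inf_le_tmp => _ [l [l0 fl] <-]; exists l => //; split=> //.
by rewrite (le_trans fl)// lee_fin.
Qed.

Lemma rearrangement_le f l t : 0 < l -> (mu [set x | (l < md (f x))%R] <= t%:E)%E ->
  (rearr f t <= l%:E)%E.
Proof. by move=> l0 fl; apply: ereal_inf_lbound; exists l. Qed.

Lemma lt_rearrangement f l t : 0 < l -> (l%:E < rearr f t)%E ->
  (t%:E < mu [set x | (l < md (f x))%R])%E.
Proof. by move=> l0; apply: contraTlt => fl; rewrite -leNgt rearrangement_le. Qed.

Lemma measurable_rearrangement f s :
  measurable_fun (`]0%R, s] : set (measurableTypeR R)) (rearr f).
Proof.
move=> mD; apply: (measurability _ (ErealGenOInfty.measurableE R)) => //.
move=> _ [_ [a ->] <-]; apply: is_interval_measurable => x y [/= xs xa] [ys ya] z /andP[xz zy].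
move: xs ys xa; rewrite /= !in_itv/= !andbT => /andP[x0 _] /andP[_ y_s] _.
split; first by rewrite (lt_le_trans x0 xz) (le_trans zy y_s).
move: ya; rewrite /= !in_itv/= !andbT => /lt_le_trans; apply.
exact: rearrangement_nonincreasing.
Qed.

Variables (f : T -> K) (ffe : finite_excess mu (md \o f)).

Lemma norm_md z : `|md z| = md z. Proof. exact: ger0_norm. Qed.

Let mf : measurable_fun setT (md \o f). Proof. exact: ffe.1. Qed.

Lemma measurable_level l : measurable [set x | l < md (f x)].
Proof. by apply: measurable_set_bool; exact: measurable_fun_ltr. Qed.

Lemma rearrangement_fin_num t : 0 < t -> rearr f t \is a fin_num.
Proof.
move=> t0; rewrite ge0_fin_numE ?rearrangement_ge0//.
have [_ [a a0 fa]] := ffe.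
have Efin : excess mu (md \o f) a \is a fin_num by rewrite ge0_fin_numE// excess_ge0.
(* Markov's inequality then bounds the measure of {|f| > a + b} by t; the 1 keeps b positive. *)
pose b := (fine (excess mu (md \o f) a) + 1) / t.
have E0 : 0 < fine (excess mu (md \o f) a) + 1.
  by rewrite ltr_wpDl// fine_ge0// excess_ge0.
have b0 : 0 < b by rewrite divr_gt0.
apply: (@le_lt_trans _ _ (a + b)%:E); last exact: ltry.
apply: rearrangement_le; first by rewrite ltr_wpDl.
rewrite -(@lee_pmul2l _ b%:E)//.
apply: (@le_trans _ _ (b%:E * mu [set x | (a + b <= `|(md \o f) x|)%R])%E).
  rewrite lee_pmul2l//; apply: le_measure; rewrite ?inE.
  - exact: measurable_level.
  - by apply: measurable_set_bool; apply: measurable_fun_ler => //; exact: measurableT_comp.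
  - by move=> x /= /ltW; rewrite norm_md.
apply: (le_trans (excess_markov mu a mf b0)).
by rewrite -(fineK Efin) -EFinM lee_fin /b divfK ?gt_eqF// lerDl.
Qed.

(** A real-valued rearrangement on the whole line, extended by 0 outside ]0, s], as the layer-cake
    comparison expects. *)
Definition fin_rearrangement s t : R :=
  if 0 < t <= s then fine (rearr f t) else 0.
Local Notation m := fin_rearrangement.

Lemma fin_rearrangement_ge0 s t : 0 <= m s t.
Proof. by rewrite /m; case: ifP => // _; rewrite fine_ge0// rearrangement_ge0. Qed.

Lemma fin_rearrangementE s t : 0 < t <= s -> rearr f t = (m s t)%:E.
Proof. by move=> ts; rewrite /m ts fineK// rearrangement_fin_num//; case/andP: ts. Qed.

Lemma measurable_fin_rearrangement s : measurable_fun [set: measurableTypeR R] (m s).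
Proof.
rewrite (_ : m s = (fine \o rearr f) \_ `]0%R, s]).
  apply/(measurable_restrictT _ _).1 => //.
  by apply: measurableT_comp => //; exact: measurable_rearrangement.
by apply/funext => t; rewrite patchE mem_setE in_itv.
Qed.

Lemma integral_rearrangement s :
  (\int[leb]_(t in `]0%R, s]) rearr f t = \int[leb]_t (m s t)%:E)%E.
Proof.
rewrite integral_mkcond; apply: eq_integral => t _.
rewrite patchE mem_setE in_itv/=; case: ifP => ts; first exact: fin_rearrangementE.
by rewrite /m ts.
Qed.

Lemma measurable_max_fin_rearrangement s l :
  measurable_fun [set: measurableTypeR R] (fun t => Num.max (m s t - l) 0).
Proof.
apply: measurable_maxr => //; apply: measurable_funB => //.
exact: measurable_fin_rearrangement.
Qed.

Lemma measurable_max_md l : measurable_fun setT (fun x => Num.max (md (f x) - l) 0).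
Proof. by apply: measurable_maxr => //; exact: measurable_funB. Qed.

Lemma lt_max_sub (y l r : R) : 0 < r -> (r < Num.max (y - l) 0) = (l + r < y).
Proof. by move=> r0; rewrite lt_max [r < 0]ltNge (ltW r0) orbF ltrBrDl. Qed.

Lemma le_max_subE (y l r : R) : 0 < r -> (r <= Num.max (y - l) 0) = (l + r <= y).
Proof. by move=> r0; rewrite le_max [r <= 0]leNgt r0 orbF lerBrDl. Qed.

Lemma excess_md l : (excess mu (md \o f) l = \int[mu]_x (Num.max (md (f x) - l) 0)%:E)%E.
Proof. by apply: eq_integral => x _; rewrite /= norm_md. Qed.

(** Realizes a value of [mu] as a length, so that level sets of f and of its rearrangement are
    compared by inclusions on the line. *)
Lemma lebesgue_measure_lt (c : \bar R) : (0 <= c)%E ->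
  let S := [set t : R | (0 < t)%R && (t%:E < c)%E] in measurable S /\ leb S = c.
Proof.
case: c => [c c0|_|//] /=; last first.
  rewrite (_ : [set t : R | _] = `]0%R, +oo[%classic); last first.
    by apply/seteqP; split => t /=; rewrite in_itv/= andbT ltry ?andbT.
  by rewrite lebesgue_measure_itv/= ltry.
rewrite (_ : [set t : R | _] = `]0%R, c[%classic); last first.
  by apply/seteqP; split => t /=; rewrite in_itv/= lte_fin.
rewrite lebesgue_measure_itv/= lte_fin; split=> //.
case: ltP => [_|c0']; first by rewrite oppr0 adde0.
by congr (_%:E); apply/le_anti; rewrite -lee_fin c0 c0'.
Qed.

(** On ]0, s] the rearrangement is at most its part above l plus l, and its level sets above l have
    at most the measure of those of |f|. *)
Lemma integral_rearrangement_le s l : 0 < s -> 0 <= l ->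
  (\int[leb]_(t in `]0%R, s]) rearr f t <= excess mu (md \o f) l + (l * s)%:E)%E.
Proof.
move=> s0 l0; rewrite integral_rearrangement.
pose I : R -> R := \1_(`]0%R, s]%classic).
have mI : measurable_fun [set: measurableTypeR R] I by exact: measurable_indic.
have IE t : I t = (0 < t <= s)%R%:R by rewrite /I indicE mem_setE in_itv.
have M0 t : 0 <= Num.max (m s t - l) 0 by exact: max_sub_ge0.
have I0 t : 0 <= l * I t by rewrite mulr_ge0.
have mmM := measurable_max_fin_rearrangement s l.
apply: (@le_trans _ _ (\int[leb]_t (Num.max (m s t - l) 0 + l * I t)%:E)%E).
  apply: ae_le_integral_EFin => //.
  - exact: measurable_fin_rearrangement.
  - by apply: measurable_funD => //; exact: measurable_funM.
  - by move=> t; exact: fin_rearrangement_ge0.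
  - by move=> t; rewrite addr_ge0.
  - apply: aeW => t; rewrite IE; case: (boolP (0 < t <= s)) => ts.
      by rewrite mulr1 le_max_sub.
    by rewrite /m (negbTE ts) addr_ge0 ?max_sub_ge0// mulr0.
rewrite integral_EFinD//; last exact: measurable_funM.
rewrite leeD//; last first.
  rewrite integral_EFinZ// integral_indic// setIT.
  by rewrite [X in (_ * X)%E](lebesgue_measure_itv `]0, s])/= lte_fin s0 oppr0 adde0 -EFinM.
rewrite excess_md.
apply: le_integral_levels => //; first exact: measurable_max_md.
  by move=> x; exact: max_sub_ge0.
move=> r r0.
have lr0 : 0 < l + r by rewrite ltr_wpDl.
apply: (@le_trans _ _ (mu [set x | (l + r < md (f x))%R])); last first.
  apply: le_measure; rewrite ?inE; first exact: measurable_level.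
    by apply: measurable_set_bool; apply: measurable_fun_ler => //; exact: measurable_max_md.
  by move=> x /= /ltW; rewrite le_max_subE.
have [mS SE] := lebesgue_measure_lt (measure_ge0 mu [set x | l + r < md (f x)]).
rewrite -[leRHS]SE; apply: le_measure; rewrite ?inE//.
- by apply: measurable_set_bool; exact: measurable_fun_ltr.
- move=> t /=; rewrite lt_max_sub// /m.
  case: ifPn => [ts|_ /(lt_trans lr0)]; last by rewrite ltxx.
  have /andP[t0 _] := ts.
  move=> lr; rewrite t0/=; apply: lt_rearrangement => //.
  by rewrite -(fineK (rearrangement_fin_num t0)) lte_fin.
Qed.

(** The optimal level is the value of the rearrangement at s. It stays at least l on ]0, s], so
    splitting off l is exact, and {|f| > l + r} has measure at most s, so nothing is lost beyond
    s. *)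
Lemma exists_le_integral_rearrangement s : 0 < s -> exists2 l, 0 <= l &
  (excess mu (md \o f) l + (l * s)%:E <= \int[leb]_(t in `]0%R, s]) rearr f t)%E.
Proof.
move=> s0; have s_s : 0 < s <= s by rewrite s0 lexx.
exists (m s s); first exact: fin_rearrangement_ge0.
set l := m s s; have l0 : 0 <= l by exact: fin_rearrangement_ge0.
pose I : R -> R := \1_(`]0%R, s]%classic).
have mI : measurable_fun [set: measurableTypeR R] I by exact: measurable_indic.
have IE t : I t = (0 < t <= s)%R%:R by rewrite /I indicE mem_setE in_itv.
have M0 t : 0 <= Num.max (m s t - l) 0 by exact: max_sub_ge0.
have I0 t : 0 <= l * I t by rewrite mulr_ge0.
have mmM := measurable_max_fin_rearrangement s l.
have ml t : 0 < t <= s -> l <= m s t.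
  move=> ts; rewrite -lee_fin -(fin_rearrangementE ts) /l -(fin_rearrangementE s_s).
  by apply: rearrangement_nonincreasing; case/andP: ts.
have -> : (\int[leb]_(t in `]0%R, s]) rearr f t =
    \int[leb]_t (Num.max (m s t - l) 0 + l * I t)%:E)%E.
  rewrite integral_rearrangement; apply: eq_integral => t _; congr (_%:E); rewrite IE.
  case: (boolP (0 < t <= s)) => ts; first by rewrite mulr1 max_l ?subrK// subr_ge0 ml.
  rewrite /m (negbTE ts) mulr0 addr0 sub0r max_r// oppr_le0.
  exact: fin_rearrangement_ge0.
rewrite integral_EFinD//; last exact: measurable_funM.
rewrite leeD//; last first.
  rewrite integral_EFinZ// integral_indic// setIT.
  by rewrite [X in (_ * X)%E](lebesgue_measure_itv `]0, s])/= lte_fin s0 oppr0 adde0 -EFinM.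
rewrite excess_md; apply: le_integral_levels => //; first exact: measurable_max_md.
  by move=> x; exact: max_sub_ge0.
move=> r r0; have lr0 : 0 < l + r by rewrite ltr_wpDl.
have -> : [set x | r < Num.max (md (f x) - l) 0] = [set x | l + r < md (f x)].
  by apply/seteqP; split => x /=; rewrite lt_max_sub.
set D := mu _.
have Ds : (D <= s%:E)%E.
  have : (rearr f s < (l + r)%:E)%E.
    by rewrite (fin_rearrangementE s_s) lte_fin ltrDl.
  move=> /ereal_inf_lt[_ [k [k0 fk] <-]]; rewrite lte_fin => klr.
  apply: le_trans fk; apply: le_measure; rewrite ?inE; [exact: measurable_level..|].
  by move=> x /=; exact: lt_trans.
have [mS SE] := lebesgue_measure_lt (measure_ge0 mu [set x | l + r < md (f x)]).
rewrite -[leLHS]SE; apply: le_measure; rewrite ?inE//.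
  by apply: measurable_set_bool; exact: measurable_fun_ler.
move=> t /= /andP[t0 tD]; rewrite le_max_subE//.
have ts : 0 < t <= s by rewrite t0 -lee_fin (le_trans (ltW tD)).
rewrite -lee_fin -(fin_rearrangementE ts); apply: le_ereal_inf_tmp => _ [k [k0 fk] <-].
rewrite lee_fin leNgt; apply/negP => klr.
suff : (t%:E < t%:E)%E by rewrite ltxx.
apply: (lt_le_trans tD); apply: le_trans fk.
apply: le_measure; rewrite ?inE; [exact: measurable_level..|].
by move=> x /=; exact: lt_trans.
Qed.

End rearrangement.

(** * Submajorization from excesses and level sets *)

Section submajorization.
Context d (T : measurableType d) (R : realType) (mu : {measure set T -> \bar R}).
Context (K : numFieldType) (md : K -> R).
Hypothesis md_ge0 : forall z, 0 <= md z.
Implicit Types f g : T -> K.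

(** The level that is optimal for f is admissible for g. *)
Lemma submajorized_excess f g : finite_excess mu (md \o f) ->
  finite_excess mu (md \o g) ->
  (forall l : R, 0 <= l -> (excess mu (md \o g) l <= excess mu (md \o f) l)%E) ->
  submajorized mu md g f.
Proof.
move=> ff fg gf s s0; have [l l0 fl] := exists_le_integral_rearrangement md_ge0 ff s0.
apply: le_trans fl; apply: le_trans (integral_rearrangement_le md_ge0 fg s0 l0) _.
by rewrite leeD2r// gf.
Qed.

(** The rearrangement of 1 is at most 1, while every level admissible for c f is at least 1. *)
Lemma submajorized_cst1 f c : md 1 = 1 ->
  (forall r : R, 0 <= r < 1 -> mu [set x | (r < md (c * f x))%R] = +oo%E) ->
  submajorized mu md (fun=> 1) (fun x => c * f x).
Proof.
move=> md1 fc s s0; apply: ge0_le_integral => //.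
- by move=> t _; exact: rearrangement_ge0.
- exact: measurable_rearrangement.
- exact: measurable_rearrangement.
- move=> t /=; rewrite in_itv/= => /andP[t0 _].
  apply: (@le_trans _ _ 1%:E).
    apply: rearrangement_le => //; rewrite md1.
    by rewrite (_ : [set x | _] = set0) ?measure0 ?lee_fin ?ltW//; apply/seteqP; split=> x //=; rewrite ltxx.
  apply: le_ereal_inf_tmp => _ [k [k0 fk] <-]; rewrite lee_fin leNgt; apply/negP => k1.
  by move: fk; rewrite fc ?(ltW k0)//.
Qed.

End submajorization.

(** * Real and complex function spaces *)

(* What the real and complex cases have in common; in [mod_clip], c is f
   truncated radially at height a. *)
Record modulus d (T : measurableType d) (R : realType) (K : numFieldType)
    (md : K -> R) : Prop := {
  mod_ge0 : forall z, 0 <= md z ;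
  mod_add : forall y z, md (y + z) <= md y + md z ;
  mod_mul : forall y z, md (y * z) = md y * md z ;
  mod_nat : forall n, md n%:R = n%:R ;
  mod_inv : forall z, md z^-1 = (md z)^-1 ;
  mod_surj : forall r, 0 <= r -> exists c, md c = r ;
  mod_cvg : forall (u : nat -> K) z, u n @[n --> \oo] --> z ->
    md (u n) @[n --> \oo] --> md z ;
  mod_borel : forall f : T -> K, borel_fun f -> measurable_fun setT (md \o f) ;
  mod_borelD : forall f g : T -> K, borel_fun f -> borel_fun g ->
    borel_fun (fun x => f x + g x) ;
  mod_borelM : forall (c : K) (f : T -> K), borel_fun f -> borel_fun (fun x => c * f x) ;
  mod_clip : forall (f : T -> K) (a : R), borel_fun f -> 0 <= a ->
    exists c : T -> K, [/\ borel_fun c, borel_fun (fun x => f x - c x),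
      forall x, md (c x) <= a & forall x, md (f x - c x) = Num.max (md (f x) - a) 0] }.

Section modulus.
Context d (T : measurableType d) (R : realType) (mu : {measure set T -> \bar R}).
Hypothesis mu_infinite : mu setT = +oo%E.
Context (K : numFieldType) (md : K -> R) (mdP : modulus T md).
Implicit Types f g : T -> K.
Local Notation L1Linfty := (L1_plus_Linfty mu md).
Local Notation fe := (finite_excess mu).

Let normr_md z : `|md z| = md z. Proof. exact: ger0_norm (mod_ge0 mdP z). Qed.

Lemma Lpnorm1 f : Lpnorm mu md 1%E f = excess mu (md \o f) 0.
Proof. by rewrite /Lpnorm Lnorm1 excess0; apply: eq_integral => x _. Qed.

Lemma Lpnormy_le f a : (Lpnorm mu md +oo%E f <= a%:E)%E <->
  \forall x \ae mu, md (f x) <= a.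
Proof.
(* [Lnorm] at infinity is the essential supremum only on a space of positive measure. *)
rewrite /Lpnorm unlock mu_infinite ltry.
have E x : ((abse \o (fun x => (md (f x))%:E)) x <= a%:E)%E = (md (f x) <= a).
  by rewrite /= lee_fin normr_md.
split=> [/ess_supP|H]; last apply/ess_supP.
  by apply: filterS => x; rewrite E.
by apply: filterS H => x; rewrite E.
Qed.

(** If |h| <= M, the excess of g + h over M is at most the L^1 norm of g; conversely, truncation at
    a level of finite excess gives a decomposition. *)
Lemma L1_plus_LinftyP f : L1Linfty f <-> borel_fun f /\ fe (md \o f).
Proof.
split=> [[g [h [[bg g1] [bh hoo] ->]]]|[bf [mf [a a0 fa]]]].
- have bgh := mod_borelD mdP bg bh; split=> //; split; first exact: mod_borel.
  have [M M0 hM] : exists2 M : R, 0 <= M & \forall x \ae mu, md (h x) <= M.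
    have h0 : (0 <= Lpnorm mu md +oo%E h)%E by exact: Lnorm_ge0.
    exists (fine (Lpnorm mu md +oo%E h)); first exact: fine_ge0.
    by apply/Lpnormy_le; rewrite fineK// ge0_fin_numE.
  exists M => //; rewrite Lpnorm1 in g1; apply: le_lt_trans g1; rewrite excess0.
  apply: excess_le_integral => //; first exact: mod_borel.
    by apply: measurableT_comp => //; exact: mod_borel.
  apply: filterS hM => x hx /=; rewrite !normr_md.
  by rewrite (le_trans (mod_add mdP _ _))// lerD2l.
- have [c [bc br ca rE]] := mod_clip mdP bf a0.
  exists (fun x => f x - c x), c; split.
  + split=> //; rewrite Lpnorm1 excess0; apply: le_lt_trans fa.
    rewrite le_eqVlt; apply/orP; left; apply/eqP; apply: eq_integral => x _ /=.
    by rewrite !normr_md rE.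
  + split=> //; apply: (@le_lt_trans _ _ a%:E); last exact: ltry.
    by apply/Lpnormy_le; exact: aeW.
  + by apply/funext => x; rewrite subrK.
Qed.

Lemma L1_plus_LinftyD f g : L1Linfty f -> L1Linfty g -> L1Linfty (fun x => f x + g x).
Proof.
move=> /L1_plus_LinftyP[bf ff] /L1_plus_LinftyP[bg fg]; apply/L1_plus_LinftyP.
have bfg := mod_borelD mdP bf bg; split=> //.
apply: finite_excess_le (finite_excessD ff fg) _; first exact: mod_borel.
apply: aeW => x /=; rewrite normr_md ger0_norm ?addr_ge0 ?(mod_ge0 mdP)//.
exact: (mod_add mdP).
Qed.

Lemma L1_plus_LinftyZ c f : L1Linfty f -> L1Linfty (fun x => c * f x).
Proof.
move=> /L1_plus_LinftyP[bf ff]; apply/L1_plus_LinftyP.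
have bcf := mod_borelM mdP c bf; split=> //.
apply: finite_excess_le (finite_excessZ (md c) ff) _; first exact: mod_borel.
by apply: aeW => x /=; rewrite normrM !normr_md (mod_mul mdP).
Qed.

Lemma L1_plus_Linfty_cst c : L1Linfty (fun=> c).
Proof.
apply/L1_plus_LinftyP; split; last exact: finite_excess_cst.
move=> U _; have [Uc|Uc] := pselect (U c).
  by rewrite (_ : _ @^-1` _ = setT)//; apply/seteqP; split.
by rewrite (_ : _ @^-1` _ = set0)//; apply/seteqP; split.
Qed.

Lemma mod0 : md 0 = 0. Proof. exact: mod_nat mdP 0%N. Qed.

Lemma mod_sum n (F : nat -> K) : md (\sum_(k < n) F k) <= \sum_(k < n) md (F k).
Proof.
elim: n => [|n IHn]; first by rewrite !big_ord0 mod0.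
by rewrite !big_ord_recr/= (le_trans (mod_add mdP _ _))// lerD2r.
Qed.

Variables (A : (T -> K) -> T -> K) (dsA : dunford_schwartz mu md A).

Lemma dunford_schwartz_excess f a : L1Linfty f -> 0 <= a ->
  (excess mu (md \o A f) a <= excess mu (md \o f) a)%E.
Proof.
move=> Lf a0; have /L1_plus_LinftyP[bf [mf _]] := Lf.
have [fa|] := ltP (excess mu (md \o f) a) +oo%E; last first.
  by rewrite leye_eq => /eqP ->; rewrite leey.
have [c [bc br ca rE]] := mod_clip mdP bf a0.
have rE1 : Lpnorm mu md 1%E (fun x => f x - c x) = excess mu (md \o f) a.
  by rewrite Lpnorm1 excess0; apply: eq_integral => x _ /=; rewrite !normr_md rE.
have Lr : Lp mu md 1%E (fun x => f x - c x) by split=> //; rewrite /= rE1.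
have cay : (Lpnorm mu md +oo%E c <= a%:E)%E by apply/Lpnormy_le; exact: aeW.
have Lc : Lp mu md +oo%E c by split=> //; rewrite (le_lt_trans cay)// ltry.
have Sr : L1Linfty (fun x => f x - c x).
  apply/L1_plus_LinftyP; split=> //; split; first exact: mod_borel.
  by exists 0 => //; rewrite -Lpnorm1 rE1.
have Sc : L1Linfty c.
  apply/L1_plus_LinftyP; split=> //.
  apply: (@finite_excess_bounded _ _ _ _ _ a); first exact: mod_borel.
  by apply: aeW => x /=; rewrite normr_md.
have mA g : L1Linfty g -> measurable_fun setT (md \o A g).
  by move=> /(ds_stable dsA)/L1_plus_LinftyP[bAg _]; exact: mod_borel.
have Aca : \forall x \ae mu, md (A c x) <= a.
  by apply/Lpnormy_le; apply: le_trans cay; exact: ds_normy.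
rewrite -rE1; apply: le_trans (ds_norm1 dsA Lr); rewrite Lpnorm1 excess0.
apply: excess_le_integral; [exact: mA|by apply: measurableT_comp => //; exact: mA|by []|].
have fE : f = (fun x => (f x - c x) + c x) by apply/funext => x; rewrite subrK.
apply: filterS2 (ds_add dsA Sr Sc) Aca => x /(_ I); rewrite -fE /= => -> Acx.
by rewrite !normr_md (le_trans (mod_add mdP _ _))// lerD2l.
Qed.

Lemma L1_plus_Linfty_iter f k : L1Linfty f -> L1Linfty (iter k A f).
Proof. by move=> Lf; elim: k => //= k; exact: ds_stable dsA _. Qed.

Lemma L1_plus_Linfty_avg f n : L1Linfty f -> L1Linfty (ergodic_average A f n).
Proof.
move=> Lf; apply: L1_plus_LinftyZ; elim: n => [|n IHn].
  by under eq_fun do rewrite big_ord0; exact: L1_plus_Linfty_cst.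
under eq_fun do rewrite big_ord_recr.
by apply: L1_plus_LinftyD => //; exact: L1_plus_Linfty_iter.
Qed.

(** The positive part of |z| - a is a convex function of z, so its value at an average is at most
    the average of its values. The average over no terms is 0. *)
Lemma ergodic_average_excess f a n : L1Linfty f -> 0 <= a ->
  (excess mu (md \o ergodic_average A f n) a <= excess mu (md \o f) a)%E.
Proof.
move=> Lf a0.
have miter k : measurable_fun setT (md \o iter k A f).
  by have /L1_plus_LinftyP[b _] := L1_plus_Linfty_iter k Lf; exact: mod_borel.
have eiter k : (excess mu (md \o iter k A f) a <= excess mu (md \o f) a)%E.
  elim: k => [|k IHk] //=; apply: le_trans IHk.
  by apply: dunford_schwartz_excess => //; exact: L1_plus_Linfty_iter.
have mavg : measurable_fun setT (md \o ergodic_average A f n).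
  by have /L1_plus_LinftyP[b _] := L1_plus_Linfty_avg n Lf; exact: mod_borel.
have [->|n0] := eqVneq n 0%N.
  rewrite (excess_eq0 mu _ _).1 ?excess_ge0//.
    have /L1_plus_LinftyP[b _] := L1_plus_Linfty_avg 0 Lf; exact: mod_borel.
  by apply: aeW => x /=; rewrite normr_md /ergodic_average big_ord0 mulr0 mod0.
pose F k x := Num.max (`|(md \o iter k A f) x| - a) 0.
have F0 k x : 0 <= F k x by exact: max_sub_ge0.
have mF k : measurable_fun setT (F k) by exact: measurable_excess.
apply: (@le_trans _ _ (\int[mu]_x (n%:R^-1 * \sum_(k < n) F k x)%:E)%E).
  apply: excess_le_integral => //.
  - by apply: measurable_funM => //; exact: measurable_sum.
  - by move=> x; rewrite mulr_ge0// sumr_ge0.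
  - apply: aeW => x /=; rewrite normr_md (mod_mul mdP) (mod_inv mdP) (mod_nat mdP).
    rewrite -(ler_pM2l (x := n%:R)) ?ltr0n ?lt0n// mulrDr !mulVKf ?pnatr_eq0//.
    apply: (le_trans (mod_sum n (fun k => iter k A f x))).
    apply: (@le_trans _ _ (\sum_(k < n) (F k x + a))).
      by apply: ler_sum => k _; rewrite -[leLHS]normr_md; exact: le_max_sub.
    by rewrite big_split/= sumr_const card_ord mulr_natl.
rewrite integral_EFinZ ?invr_ge0//; [|exact: measurable_sum|by move=> x; exact: sumr_ge0].
have [->|fin] := eqVneq (excess mu (md \o f) a) +oo%E; first by rewrite leey.
have {}fin : excess mu (md \o f) a \is a fin_num by rewrite ge0_fin_numE ?excess_ge0// ltey.
under eq_integral do rewrite -sumEFin.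
rewrite ge0_integral_sum//; [|by move=> k; exact/measurable_EFinP|by move=> k x _; rewrite lee_fin].
apply: (@le_trans _ _ (n%:R^-1%:E * \sum_(k < n) (excess mu (md \o f) a))%E).
  apply: lee_wpmul2l; first by rewrite lee_fin invr_ge0.
  by apply: lee_sum => k _; exact: eiter.
by rewrite -(fineK fin) sumEFin sumr_const card_ord -EFinM -[fine _ *+ _]mulr_natl mulKf ?pnatr_eq0.
Qed.

Variables (E : set (T -> K)) (N : (T -> K) -> R) (fsE : fully_symmetric mu md E N).

Lemma fully_symmetric_limit f fhat : E f -> borel_fun fhat ->
  cvg_ae mu (ergodic_average A f) fhat -> E fhat.
Proof.
move=> Ef bfh fh; have Lf := bs_sub (fs_banach fsE) Ef.
have /L1_plus_LinftyP[bf ff] := Lf.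
have mfh := mod_borel mdP bfh.
have fhf a : 0 <= a -> (excess mu (md \o fhat) a <= excess mu (md \o f) a)%E.
  move=> a0; apply: (@integral_limit_le _ _ _ mu
      (fun n x => Num.max (`|(md \o ergodic_average A f n) x| - a) 0)).
  - move=> n; apply: measurable_excess.
    by have /L1_plus_LinftyP[b _] := L1_plus_Linfty_avg n Lf; exact: mod_borel.
  - exact: measurable_excess.
  - by move=> n x; exact: max_sub_ge0.
  - by move=> x; exact: max_sub_ge0.
  - apply: filterS fh => x fhx /=; apply: cvg_max0; apply: cvgB; last exact: cvg_cst.
    by apply: cvg_norm; exact: (mod_cvg mdP).
  - by move=> n; exact: ergodic_average_excess.
have ffh : fe (md \o fhat).
  split=> //; have [_ [a a0 fa]] := ff; exists a => //.
  exact: le_lt_trans (fhf a a0) fa.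
have Lfh : L1Linfty fhat by apply/L1_plus_LinftyP.
suff sm : submajorized mu md fhat f by have [] := fs_submajorized fsE Ef Lfh sm.
by apply: submajorized_excess => //; exact: (mod_ge0 mdP).
Qed.

(** Scaling by a constant of modulus 1/l turns {|f| > l} into the set where the modulus exceeds 1,
    which is the situation of [submajorized_cst1]. *)
Lemma fully_symmetric_levels f (l : R) : ~ E (fun=> 1) -> E f -> 0 < l ->
  (mu [set x | (l < md (f x))%R] < +oo)%E.
Proof.
move=> E1 Ef l0; rewrite ltey; apply/eqP => fl; apply: E1.
have [c cl] : exists c, md c = l^-1 by apply: (mod_surj mdP); rewrite invr_ge0 ltW.
have Ecf := bs_scale (fs_banach fsE) c Ef.
have /L1_plus_LinftyP[bcf _] := bs_sub (fs_banach fsE) Ecf.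
have /L1_plus_LinftyP[bf _] := bs_sub (fs_banach fsE) Ef.
suff sm : submajorized mu md (fun=> 1) (fun x => c * f x).
  by have [] := fs_submajorized fsE Ecf (L1_plus_Linfty_cst 1) sm.
apply: submajorized_cst1; [exact: mod_nat mdP 1%N|] => r /andP[r0 r1].
apply/eqP; rewrite -leye_eq -fl; apply: le_measure; rewrite ?inE.
- by apply: measurable_set_bool; apply: measurable_fun_ltr => //; exact: mod_borel.
- by apply: measurable_set_bool; apply: measurable_fun_ltr => //; exact: mod_borel.
- move=> x /= lf; rewrite (mod_mul mdP) cl (lt_trans r1)//.
  by rewrite ltr_pdivlMl// mulr1.
Qed.

End modulus.

(** * Real scalars *)

Section real_case.
Context d (T : measurableType d) (R : realType) (mu : {measure set T -> \bar R}).
Hypothesis mu_infinite : mu setT = +oo%E.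

Lemma real_modulusP : modulus T (@real_modulus R).
Proof.
rewrite /real_modulus; split.
- by move=> z; exact: normr_ge0.
- exact: ler_normD.
- exact: normrM.
- exact: normr_nat.
- exact: normfV.
- by move=> r r0; exists r; exact: ger0_norm.
- by move=> u z uz; exact: cvg_norm.
- by move=> f /borel_funE mf; exact: measurableT_comp.
- by move=> f g /borel_funE mf /borel_funE mg; apply/borel_funE; exact: measurable_funD.
- by move=> c f /borel_funE mf; apply/borel_funE; exact: measurable_funM.
- move=> f a /borel_funE mf a0; have mc := measurable_clip a mf.
  exists (fun x => clip a (f x)); split.
  + exact/borel_funE.
  + by apply/borel_funE; exact: measurable_funB.
  + by move=> x; exact: norm_clip_le.
  + by move=> x; exact: norm_sub_clip.
Qed.

Lemma excess_normr (f : T -> R) a : excess mu (@real_modulus R \o f) a = excess mu f a.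
Proof. by apply: eq_integral => x _; rewrite /= /real_modulus normr_id. Qed.

Lemma real_L1_plus_LinftyP (f : T -> R) :
  L1_plus_Linfty mu (@real_modulus R) f <-> finite_excess mu f.
Proof.
split=> [/(L1_plus_LinftyP mu_infinite real_modulusP)|[mf [a a0 fa]]].
  by move=> [/borel_funE mf [_ [a a0 fa]]]; split=> //; exists a => //; rewrite -excess_normr.
apply/(L1_plus_LinftyP mu_infinite real_modulusP); split; first exact/borel_funE.
by split; [exact: measurableT_comp|exists a => //; rewrite excess_normr].
Qed.

Lemma dunford_schwartz_excess_contraction A :
  dunford_schwartz mu (@real_modulus R) A -> excess_contraction mu A.
Proof.
move=> dsA; split.
- by move=> f /real_L1_plus_LinftyP/(ds_stable dsA)/real_L1_plus_LinftyP.
- move=> f g /real_L1_plus_LinftyP Lf /real_L1_plus_LinftyP Lg fg.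
  have fg' : f = g %[ae mu] by apply: filterS fg.
  by apply: filterS (ds_ae dsA Lf Lg fg') => x /(_ I).
- move=> f g /real_L1_plus_LinftyP Lf /real_L1_plus_LinftyP Lg.
  by apply: filterS (ds_add dsA Lf Lg) => x /(_ I).
- move=> c f /real_L1_plus_LinftyP Lf.
  by apply: filterS (ds_scale dsA c Lf) => x /(_ I).
- move=> f a /real_L1_plus_LinftyP Lf a0; rewrite -(excess_normr (A f)) -(excess_normr f).
  exact: (dunford_schwartz_excess mu_infinite real_modulusP dsA).
Qed.

End real_case.

(** * Complex scalars *)

Section complex_case.
Context d (T : measurableType d) (R : realType) (mu : {measure set T -> \bar R}).
Hypothesis mu_infinite : mu setT = +oo%E.
Local Notation normc := (@complex_modulus R).
Local Open Scope complex_scope.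
(* [R[i]] has a topology only as a [numFieldType]. *)
Local Notation C := (R[i] : numFieldType).
Local Notation ofR := (real_complex R).
Local Notation Re := (@complex.Re R).
Local Notation Im := (@complex.Im R).

Lemma normcE (z : R[i]) : `|z| = ofR (normc z).
Proof. by []. Qed.

Lemma Re_normc_le (z : R[i]) : `|Re z| <= normc z.
Proof. by rewrite -lecR -normcE normc_ge_Re. Qed.

Lemma normc_le (z : R[i]) : normc z <= `|Re z| + `|Im z|.
Proof.
case: z => a b /=; rewrite -[leRHS]ger0_norm ?addr_ge0// -sqrtr_sqr ler_wsqrtr//.
rewrite -[a ^+ 2]real_normK ?num_real// -[b ^+ 2]real_normK ?num_real//.
by rewrite sqrrD lerD2r lerDl mulrn_wge0// mulr_ge0.
Qed.

Lemma Im_normc_le (z : R[i]) : `|Im z| <= normc z.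
Proof.
case: z => a b /=; rewrite -sqrtr_sqr ler_wsqrtr//.
by rewrite lerDr sqr_ge0.
Qed.

Lemma ReD (y z : R[i]) : Re (y + z) = Re y + Re z. Proof. by case: y; case: z. Qed.
Lemma ImD (y z : R[i]) : Im (y + z) = Im y + Im z. Proof. by case: y; case: z. Qed.
Lemma ReB (y z : R[i]) : Re (y - z) = Re y - Re z. Proof. by case: y; case: z. Qed.
Lemma ImB (y z : R[i]) : Im (y - z) = Im y - Im z. Proof. by case: y; case: z. Qed.

Lemma ReM (r : R) (z : R[i]) : Re (ofR r * z) = r * Re z.
Proof. by case: z => a b /=; rewrite mul0r subr0. Qed.

Lemma ImM (r : R) (z : R[i]) : Im (ofR r * z) = r * Im z.
Proof. by case: z => a b /=; rewrite mul0r addr0. Qed.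

Lemma cvg_contraction (g : C -> R) (u : nat -> C) (z : C) :
  (forall y z, `|g y - g z| <= normc (y - z)) ->
  u n @[n --> \oo] --> z -> g (u n) @[n --> \oo] --> g z.
Proof.
move=> gP uz; apply/cvgrPdist_lt => e e0.
have ez : 0 < ofR e by rewrite ltcR.
move/cvgrPdist_lt : uz => /(_ _ ez); apply: filterS => n.
by rewrite normcE ltcR; exact: le_lt_trans.
Qed.

Lemma cvg_complex (u : nat -> C) (z : C) :
  Re (u n) @[n --> \oo] --> Re z -> Im (u n) @[n --> \oo] --> Im z ->
  u n @[n --> \oo] --> z.
Proof.
move=> uRe uIm; apply/cvgrPdist_lt => e e0.
  (* Radii in [R[i]] are complex numbers; a positive one is real. *)
  have [eI eR] : Im e = 0 /\ 0 < Re e by move: e0; rewrite ltcE => /andP[/eqP].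
  have eE : e = ofR (Re e) by case: e eI {e0 eR} => a b /= ->.
  have e2 : 0 < Re e / 2 by rewrite divr_gt0.
  move/cvgrPdist_lt : uRe => /(_ _ e2) uRe; move/cvgrPdist_lt : uIm => /(_ _ e2).
  apply: filterS2 uRe => n Ren Imn; rewrite eE normcE ltcR.
  rewrite (le_lt_trans (normc_le _))// ReB ImB; lra.
Qed.

Lemma open_preimage_contraction (g : C -> R) (U : set R) :
  (forall y z, `|g y - g z| <= normc (y - z)) -> open U -> open (g @^-1` U).
Proof.
move=> gP oU; rewrite openE => z Uz.
have /nbhs_ballP[e e0 eU] : nbhs (g z) U by exact: open_nbhs_nbhs.
apply/nbhs_ballP; exists (ofR e); first by rewrite /= ltcR.
move=> w; rewrite /ball/= normcE ltcR => zw; apply: eU.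
exact: le_lt_trans (gP z w) zw.
Qed.

(** The side 2/(n+1) leaves room for a square of half that size around a rational point within
    1/(n+1) of z in each coordinate. *)
Lemma open_complex_square (U : set C) z : open U -> U z ->
  exists2 n : nat, True & forall w, `|Re z - Re w| < 2 * n.+1%:R^-1 ->
    `|Im z - Im w| < 2 * n.+1%:R^-1 -> U w.
Proof.
move=> oU Uz; have /nbhs_ballP[e e0 eU] : nbhs z U by exact: open_nbhs_nbhs.
have [eI eR] : Im e = 0 /\ 0 < Re e by move: e0; rewrite /= ltcE => /andP[/eqP].
have eE : e = ofR (Re e) by case: e eI {e0 eR eU} => a b /= ->.
have [n ne] : exists n, 4 * n.+1%:R^-1 < Re e.
  near \oo => k; exists k; rewrite -ltr_pdivlMl//.
  near: k; have : 0 < 4^-1 * Re e by rewrite mulr_gt0.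
  move=> /(cvgr0_norm_lt _ (@cvg_harmonic R)); apply: filterS => n /=.
  by rewrite ger0_norm// harmonic_ge0.
exists n => // w Rew Imw; apply: eU; rewrite /ball/= eE normcE ltcR.
rewrite (le_lt_trans (normc_le _))// ReB ImB; apply: lt_trans (ltrD Rew Imw) _.
by move: ne; set h := _.+1%:R^-1; set r := Re e; lra.
Unshelve. all: by end_near. Qed.

(** An open set is the countable union of the squares with rational centre and half-side 1/(n+1)
    that it contains. *)
Lemma borel_complexE (f : T -> R[i]) : borel_fun f <->
  measurable_fun setT (Re \o f) /\ measurable_fun setT (Im \o f).
Proof.
split=> [bf|[mRe mIm] U oU].
  split; apply/borel_funE => U oU; rewrite comp_preimage; apply: bf.
  - by apply: open_preimage_contraction => // y z; rewrite -ReB Re_normc_le.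
  - by apply: open_preimage_contraction => // y z; rewrite -ImB Im_normc_le.
pose S (q : rat * rat * nat) : set C :=
  [set z | `|Re z - ratr q.1.1| < q.2.+1%:R^-1 /\ `|Im z - ratr q.1.2| < q.2.+1%:R^-1].
have -> : f @^-1` U = \bigcup_(q in [set q | S q `<=` U]) (f @^-1` (S q)).
  apply/seteqP; split => x; last by move=> [q /= qU Sq]; exact: qU.
  move=> Ux; have [n _ nU] := open_complex_square oU Ux.
  have n0 : 0 < n.+1%:R^-1 :> R by rewrite invr_gt0.
  have Rat (r h : R) : 0 < h -> exists q : rat, `|r - ratr q| < h.
    move=> h0; have /rat_in_itvoo[q] : r - h < r + h by lra.
    by rewrite in_itv/= => /andP[? ?]; exists q; rewrite ltr_norml; apply/andP; split; lra.
  have [q1 q1P] := Rat (Re (f x)) _ n0; have [q2 q2P] := Rat (Im (f x)) _ n0.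
  exists (q1, q2, n); last by split.
  move=> z /= [z1 z2]; apply: nU; rewrite mulr_natl mulr2n.
  - by rewrite (le_lt_trans (ler_distD (ratr q1) _ _))// ltrD// distrC.
  - by rewrite (le_lt_trans (ler_distD (ratr q2) _ _))// ltrD// distrC.
rewrite bigcup_mkcond; apply: countable_bigcupT_measurable => // q.
case: ifPn => // _; apply: measurableI.
- apply: measurable_set_bool; apply: measurable_fun_ltr => //.
  by apply: measurableT_comp => //; exact: measurable_funB.
- apply: measurable_set_bool; apply: measurable_fun_ltr => //.
  by apply: measurableT_comp => //; exact: measurable_funB.
Qed.

Lemma normc_ge0 z : 0 <= normc z.
Proof. by case: z => a b; exact: sqrtr_ge0. Qed.

Lemma normc_ofR r : normc (ofR r) = `|r|.
Proof. by rewrite /complex_modulus/= expr0n/= addr0 sqrtr_sqr. Qed.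

Lemma normc_dist (y z : R[i]) : `|normc y - normc z| <= normc (y - z).
Proof.
rewrite -lecR -normcE; apply: le_trans (ler_dist_dist y z).
by rewrite !normcE -rmorphB lecR [leRHS]normc_ofR.
Qed.

Lemma complex_modulusP : modulus T (@complex_modulus R).
Proof.
split.
- exact: normc_ge0.
- by move=> y z; rewrite -lecR rmorphD/= -!normcE ler_normD.
- exact: ComplexField.Normc.normcM.
- by move=> n; apply: complexI; rewrite -normcE normr_nat rmorph_nat.
- exact: ComplexField.Normc.normcV.
- by move=> r r0; exists (ofR r); rewrite normc_ofR ger0_norm.
- by move=> u z uz; exact: (cvg_contraction normc_dist).
- move=> f bf; apply/borel_funE => U oU; rewrite comp_preimage; apply: bf.
  exact: open_preimage_contraction normc_dist oU.
- move=> f g /borel_complexE[mRf mIf] /borel_complexE[mRg mIg]; apply/borel_complexE; split.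
  + rewrite (_ : _ \o _ = (fun x => Re (f x) + Re (g x))); first exact: measurable_funD.
    by apply/funext => x; rewrite /= ReD.
  + rewrite (_ : _ \o _ = (fun x => Im (f x) + Im (g x))); first exact: measurable_funD.
    by apply/funext => x; rewrite /= ImD.
- move=> c f /borel_complexE[mRf mIf]; apply/borel_complexE; split.
  + rewrite (_ : _ \o _ = (fun x => Re c * Re (f x) - Im c * Im (f x))).
      by apply: measurable_funB; exact: measurable_funM.
    by apply/funext => x /=; case: c; case: (f x).
  + rewrite (_ : _ \o _ = (fun x => Re c * Im (f x) + Im c * Re (f x))).
      by apply: measurable_funD; exact: measurable_funM.
    by apply/funext => x /=; case: c; case: (f x).
(* Height 0 is separate, since the factor [k] below divides by the maximum of |f| and a. *)
- move=> f a bf; rewrite le_eqVlt => /predU1P[<-|a0].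
    exists (fun=> 0); split.
    + by apply/borel_complexE; split; exact: measurable_cst.
    + by under eq_fun do rewrite subr0.
    + by move=> x; rewrite normc_ofR normr0.
    + by move=> x; rewrite !subr0 max_l// normc_ge0.
  (* Radial truncation multiplies f by [k] of its modulus: 1 where |f| <= a, and a / |f|
     elsewhere. *)
  pose k y := a * (Num.max y a)^-1.
  have ck : continuous k.
    move=> y; apply: cvgMr; apply: cvgV.
      by rewrite gt_eqF// lt_max a0 orbT.
    by apply: (@continuous_max R R id (cst a)); [exact: cvg_id|exact: cvg_cst].
  have [mRf mIf] := (borel_complexE f).1 bf.
  have mnf : measurable_fun setT (normc \o f).
    apply/borel_funE => U oU; rewrite comp_preimage; apply: bf.
    exact: open_preimage_contraction normc_dist oU.
  have mk : measurable_fun setT (fun x => k (normc (f x))).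
    by apply: measurableT_comp mnf; exact: continuous_measurable_fun.
  have k_ge0 y : 0 <= k y by rewrite mulr_ge0 ?(ltW a0)// invr_ge0 le_max (ltW a0) orbT.
  have kfa y : 0 <= y -> y - k y * y = Num.max (y - a) 0.
    move=> y0; rewrite /k; have [ya|ay] := leP y a.
      by rewrite mulfV ?gt_eqF// mul1r subrr max_r// subr_le0.
    by rewrite divfK ?gt_eqF ?(lt_trans a0)// max_l// subr_ge0 ltW.
  exists (fun x => ofR (k (normc (f x))) * f x); split.
  + apply/borel_complexE; split.
    * rewrite (_ : _ \o _ = (fun x => k (normc (f x)) * Re (f x))); first exact: measurable_funM.
      by apply/funext => x; rewrite /= ReM.
    * rewrite (_ : _ \o _ = (fun x => k (normc (f x)) * Im (f x))); first exact: measurable_funM.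
      by apply/funext => x; rewrite /= ImM.
  + apply/borel_complexE; split.
    * rewrite (_ : _ \o _ = (fun x => Re (f x) - k (normc (f x)) * Re (f x))).
        by apply: measurable_funB => //; exact: measurable_funM.
      by apply/funext => x; rewrite /= ReB ReM.
    * rewrite (_ : _ \o _ = (fun x => Im (f x) - k (normc (f x)) * Im (f x))).
        by apply: measurable_funB => //; exact: measurable_funM.
      by apply/funext => x; rewrite /= ImB ImM.
  + move=> x; rewrite [leLHS]ComplexField.Normc.normcM -/(normc _) -/(normc _).
    rewrite normc_ofR ger0_norm//.
    have := kfa _ (normc_ge0 (f x)); have := le_max_sub (normc (f x)) a; lra.
  + move=> x; rewrite -kfa ?normc_ge0//.
    rewrite -[X in normc (X - _)]mul1r -mulrBl -(rmorph1 ofR) -rmorphB.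
    rewrite [LHS]ComplexField.Normc.normcM -/(normc _) -/(normc _) normc_ofR ger0_norm.
      by rewrite mulrBl mul1r.
    rewrite subr_ge0 /k ler_pdivrMr ?mul1r ?le_max ?lexx ?orbT//.
    by rewrite lt_max a0 orbT.
Qed.

Variables (A : (T -> R[i]) -> T -> R[i]).
Hypothesis dsA : dunford_schwartz mu normc A.
Hypothesis posA : positive_operator mu normc A.
Local Notation LC := (L1_plus_Linfty mu normc).
Local Notation fe := (finite_excess mu).

(** Taking the real part gives a real value at every point; almost everywhere it discards nothing,
    by [operator_ofR]. *)
Definition real_restriction (g : T -> R) : T -> R :=
  fun x => Re (A (fun y => ofR (g y)) x).
Local Notation B := real_restriction.

Lemma L1_plus_Linfty_ofR (g : T -> R) : fe g -> LC (fun x => ofR (g x)).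
Proof.
move=> fg; have [mg _] := fg; apply/(L1_plus_LinftyP mu_infinite complex_modulusP).
have bg : borel_fun (fun x => ofR (g x)).
  by apply/borel_complexE; split; [exact: mg|exact: measurable_cst].
split=> //; apply: (finite_excess_le _ fg); first exact: (mod_borel complex_modulusP).
by apply: aeW => x; rewrite [(normc \o _) x]normc_ofR normr_id.
Qed.

Lemma L1_plus_Linfty_part (p : R[i] -> R) (f : T -> R[i]) :
  (forall z, `|p z| <= normc z) -> measurable_fun setT (p \o f) -> LC f -> fe (p \o f).
Proof.
move=> pn mpf /(L1_plus_LinftyP mu_infinite complex_modulusP)[bf ff].
apply: (finite_excess_le mpf ff); apply: aeW => x /=.
by rewrite [leRHS]ger0_norm ?normc_ge0.
Qed.

Lemma L1_plus_Linfty_Re f : LC f -> fe (Re \o f).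
Proof.
move=> Lf; apply: L1_plus_Linfty_part => //; first exact: Re_normc_le.
by have /(L1_plus_LinftyP mu_infinite complex_modulusP)[/borel_complexE[]] := Lf.
Qed.

Lemma L1_plus_Linfty_Im f : LC f -> fe (Im \o f).
Proof.
move=> Lf; apply: L1_plus_Linfty_part => //; first exact: Im_normc_le.
by have /(L1_plus_LinftyP mu_infinite complex_modulusP)[/borel_complexE[]] := Lf.
Qed.

Lemma real_restriction_excess_contraction : excess_contraction mu B.
Proof.
split.
- by move=> g /L1_plus_Linfty_ofR/(ds_stable dsA)/L1_plus_Linfty_Re.
- move=> g h fg fh gh.
  have gh' : (fun x => ofR (g x)) = (fun x => ofR (h x)) %[ae mu].
    by apply: filterS gh => x -> _.
  apply: filterS (ds_ae dsA (L1_plus_Linfty_ofR fg) (L1_plus_Linfty_ofR fh) gh') => x.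
  by move=> /(_ I); rewrite /B => ->.
- move=> g h fg fh.
  apply: filterS (ds_add dsA (L1_plus_Linfty_ofR fg) (L1_plus_Linfty_ofR fh)) => x /(_ I) E.
  rewrite /B -ReD -E; congr (Re (A _ x)).
  by apply/funext => y; rewrite rmorphD.
- move=> c g fg; apply: filterS (ds_scale dsA (ofR c) (L1_plus_Linfty_ofR fg)) => x /(_ I) E.
  rewrite /B -ReM -E; congr (Re (A _ x)).
  by apply/funext => y; rewrite rmorphM.
- move=> g a fg a0; have Lg := L1_plus_Linfty_ofR fg.
  apply: (@le_trans _ _ (excess mu (normc \o (fun x => ofR (g x))) a)).
    apply: le_trans (dunford_schwartz_excess mu_infinite complex_modulusP dsA Lg a0).
    have LAg := ds_stable dsA Lg.
    have /(L1_plus_LinftyP mu_infinite complex_modulusP)[_ [mAg _]] := LAg.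
    apply: le_excess => //; first exact: (L1_plus_Linfty_Re LAg).1.
    by apply: aeW => x /=; rewrite [leRHS]ger0_norm ?normc_ge0// Re_normc_le.
  rewrite le_eqVlt; apply/orP; left; apply/eqP; apply: eq_integral => x _.
  by rewrite [(normc \o _) x]normc_ofR normr_id.
Qed.

(** A positive operator sends nonnegative functions to nonnegative, in particular real, ones; g is a
    difference of two such functions. *)
Lemma operator_ofR (g : T -> R) : fe g ->
  \forall x \ae mu, A (fun y => ofR (g y)) x = ofR (B g x).
Proof.
move=> fg; have [mg _] := fg.
pose gp x := Num.max (g x) 0; pose gn x := Num.max (- g x) 0.
have gE x : g x = gp x - gn x.
  by rewrite /gp /gn; case: (leP (g x) 0) => ?; case: (leP (- g x) 0) => ?; lra.
have fgp : fe gp.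
  apply: (finite_excess_le _ fg); first exact: measurable_maxr.
  by apply: aeW => x; rewrite /gp; case: (leP (g x) 0) => ?; rewrite ?normr0.
have fgn : fe gn.
  apply: (finite_excess_le _ fg).
    by apply: measurable_maxr => //; exact: measurable_funN.
  by apply: aeW => x; rewrite /gn; case: (leP (- g x) 0) => ?; rewrite ?normr0 ?normrN.
have pos h : fe h -> (forall x, 0 <= h x) ->
    \forall x \ae mu, Im (A (fun y => ofR (h y)) x) = 0.
  move=> fh h0; have hpos : {ae mu, forall x, 0 <= ofR (h x)}.
    by apply: aeW => x; rewrite ler0c.
  apply: filterS (posA (L1_plus_Linfty_ofR fh) hpos) => x.
  by rewrite lecE => /andP[/eqP -> _].
have Ip := pos _ fgp (fun x => ltac:(by rewrite /gp le_max lexx orbT)).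
have In := pos _ fgn (fun x => ltac:(by rewrite /gn le_max lexx orbT)).
have Es := ds_scale dsA (- 1) (L1_plus_Linfty_ofR fgn).
have Ea := ds_add dsA (L1_plus_Linfty_ofR fgp)
  (L1_plus_LinftyZ mu_infinite complex_modulusP (- 1) (L1_plus_Linfty_ofR fgn)).
apply: filterS2 (filterI Ip In) (filterI Es Ea) => x [Ipx Inx] [/(_ I) Esx /(_ I) Eax].
suff : Im (A (fun y => ofR (g y)) x) = 0.
  by rewrite /B; case: (A _ x) => a b /= ->.
have -> : (fun y => ofR (g y)) = (fun y => ofR (gp y) + - 1 * ofR (gn y)).
  by apply/funext => y; rewrite gE rmorphB/= mulN1r.
by rewrite Eax Esx mulN1r ImB Ipx Inx subr0.
Qed.

Lemma iter_complex f k : LC f -> \forall x \ae mu,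
  iter k A f x = ofR (iter k B (Re \o f) x) + 'i * ofR (iter k B (Im \o f) x).
Proof.
move=> Lf; have ecB := real_restriction_excess_contraction.
have fR := L1_plus_Linfty_Re Lf; have fI := L1_plus_Linfty_Im Lf.
elim: k => [|k IHk]; first by apply: aeW => x; exact: complexE.
have fRk := finite_excess_iter ecB k fR; have fIk := finite_excess_iter ecB k fI.
have LR := L1_plus_Linfty_ofR fRk; have LI := L1_plus_Linfty_ofR fIk.
have LiI := L1_plus_LinftyZ mu_infinite complex_modulusP ('i : R[i]) LI.
have E1 : iter k A f =
    (fun x => ofR (iter k B (Re \o f) x) + 'i * ofR (iter k B (Im \o f) x)) %[ae mu].
  by apply: filterS IHk.
have {}E1 := ds_ae dsA (L1_plus_Linfty_iter dsA k Lf)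
  (L1_plus_LinftyD mu_infinite complex_modulusP LR LiI) E1.
have E2 := ds_add dsA LR LiI; have E3 := ds_scale dsA ('i : R[i]) LI.
apply: filterS2 (filterI E1 (filterI E2 E3)) (filterI (operator_ofR fRk) (operator_ofR fIk)).
by move=> x [/(_ I) E1x [/(_ I) E2x /(_ I) E3x]] [ARx AIx] /=; rewrite E1x E2x E3x ARx AIx.
Qed.

Lemma ergodic_average_complex f : LC f -> \forall x \ae mu, forall n,
  ergodic_average A f n x = Complex (ergodic_average B (Re \o f) n x)
                                    (ergodic_average B (Im \o f) n x).
Proof.
move=> Lf; have := ae_foralln (fun k => iter_complex k Lf).
apply: filterS => x H n; rewrite /ergodic_average; under eq_bigr do rewrite H.
rewrite big_split/= -mulr_sumr -!rmorph_sum mulrDr mulrCA.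
have -> : n%:R^-1 = ofR n%:R^-1 by rewrite fmorphV rmorph_nat.
rewrite -!rmorphM; set u := _ * _; set v := _ * _.
by apply/eqP; rewrite eq_complex /= !(mul0r, mul1r, mulr0, subr0, addr0, add0r) !eqxx.
Qed.

End complex_case.

Theorem theorem4p3 (d : measure_display) (T : measurableType d) (R : realType)
    (mu : {measure set T -> \bar R})
    (mu_complete : measure_is_complete mu) (mu_infinite : mu setT = +oo%E) :
  (forall (E : set (T -> R)) (N : (T -> R) -> R) (A : (T -> R) -> (T -> R)),
    fully_symmetric mu (@real_modulus R) E N ->
    ~ E (fun=> 1) ->
    dunford_schwartz mu (@real_modulus R) A ->
    forall f : T -> R, E f ->
      exists2 fhat : T -> R, E fhat &
        cvg_ae mu (ergodic_average A f) fhat)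
  /\
  (forall (E : set (T -> R[i])) (N : (T -> R[i]) -> R)
      (A : (T -> R[i]) -> (T -> R[i])),
    fully_symmetric mu (@complex_modulus R) E N ->
    ~ E (fun=> 1) ->
    dunford_schwartz mu (@complex_modulus R) A ->
    positive_operator mu (@complex_modulus R) A ->
    forall f : T -> R[i], E f ->
      exists2 fhat : T -> R[i], E fhat &
        cvg_ae mu (ergodic_average A f) fhat).
Proof.
split=> [E N A fsE E1 dsA f Ef|E N A fsE E1 dsA posA f Ef].
- have mdP := @real_modulusP _ T R.
  have ecA := dunford_schwartz_excess_contraction mu_infinite dsA.
  have /(real_L1_plus_LinftyP mu_infinite) ff := bs_sub (fs_banach fsE) Ef.
  have cf : avg_cvg mu A f.
    apply: pointwise_ergodic => // l l0.
    exact: (fully_symmetric_levels mu_infinite mdP fsE E1 Ef l0).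
  have [fhat mfhat fhatP] := ae_cvg_measurable
    (fun n => (finite_excess_avg ecA n ff).1) cf.
  exists fhat => //; apply: (fully_symmetric_limit mu_infinite mdP dsA fsE Ef) => //.
  exact/borel_funE.
- have mdP := @complex_modulusP _ T R.
  have ecB := real_restriction_excess_contraction mu_infinite dsA.
  have Lf := bs_sub (fs_banach fsE) Ef.
  (* The level sets of a real or imaginary part lie in those of f, so they inherit finite
     measure. *)
  have part (p : R[i] -> R) : (forall z, `|p z| <= complex_modulus z) ->
      finite_excess mu (p \o f) -> exists2 u : T -> R, measurable_fun setT u &
      \forall x \ae mu, ergodic_average (real_restriction A) (p \o f) n x @[n --> \oo] --> u x.
    move=> pn fp; apply: ae_cvg_measurable.
      by move=> n; exact: (finite_excess_avg ecB n fp).1.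
    apply: pointwise_ergodic => // l l0.
    apply: le_lt_trans (fully_symmetric_levels mu_infinite mdP fsE E1 Ef l0).
    have /(L1_plus_LinftyP mu_infinite mdP)[_ [mf _]] := Lf.
    apply: le_measure; rewrite ?inE.
    + apply: measurable_set_bool; apply: measurable_fun_ltr => //.
      by apply: measurableT_comp => //; exact: fp.1.
    + by apply: measurable_set_bool; exact: measurable_fun_ltr.
    + by move=> x /= /lt_le_trans; apply; exact: pn.
  have [u mu_ uP] := part _ (@Re_normc_le _) (L1_plus_Linfty_Re mu_infinite Lf).
  have [v mv vP] := part _ (@Im_normc_le _) (L1_plus_Linfty_Im mu_infinite Lf).
  have cvgf : cvg_ae mu (ergodic_average A f) (fun x => Complex (u x) (v x)).
    apply: filterS2 (ergodic_average_complex mu_infinite dsA posA Lf) (filterI uP vP).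
    move=> x Ex [ux vx]; apply: cvg_complex => /=.
    + by under eq_fun do rewrite Ex.
    + by under eq_fun do rewrite Ex.
  exists (fun x => Complex (u x) (v x)) => //.
  (* Membership in [E] is obtained for the complex limit as a whole, through the excess of its
     modulus. *)
  apply: (fully_symmetric_limit mu_infinite mdP dsA fsE Ef) => //.
  by apply/borel_complexE.
Qed.
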